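(* Let $\mathcal{A}$ be a commutative $C^*$-algebra. Then: (a) Let $E$ be a Hilbert $C^*$-module over $\mathcal{A}$ and $L\subset E$ a closed $\mathcal{A}$-submodule. For each $x_0\in E\setminus L$ there exists a pure state $\omega$ on $\mathcal{A}$ such that $\iota_\omega(x_0)$ is not in the closure of $\iota_\omega(L)$ in $E^\omega$. In particular, if $L\ne E$, there exists a pure state $\omega$ such that $\iota_\omega(L)$ is not dense in $E^\omega$ and hence $\iota_\omega(L)^\perp\neq\{0\}$. (b) Let $A\subset\mathcal{A}_+$ be a nonempty closed $\mathcal{A}$-convex subset of the positive cone of $\mathcal{A}$. If $0\notin A$, then there exist $\varepsilon>0$ and a pure state $\omega$ on $\mathcal{A}$ such that $\omega(a)\ge\varepsilon$ for all $a\in A$. (c) The implication (b) $\Rightarrow$ (a) holds.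
   Context: $C^*$-algebras are not assumed unital. A Hilbert $C^*$-module $E$ over $\mathcal{A}$ is a right $\mathcal{A}$-module with an $\mathcal{A}$-valued inner product $\langle\cdot,\cdot\rangle$ (conjugate linear in the first, linear in the second variable), complete in the norm $\|x\|=\|\langle x,x\rangle\|^{1/2}$. For a state $\omega$ on $\mathcal{A}$, put $\langle x,y\rangle_\omega=\omega(\langle x,y\rangle)$ on $E$ and $\mathcal{N}_\omega=\{x\in E:\langle x,x\rangle_\omega=0\}$; $E^\omega$ is the Hilbert space completion of $E/\mathcal{N}_\omega$ and $\iota_\omega:E\to E^\omega$ is the natural map. Let $\mathcal{A}^+$ be $\mathcal{A}$ if $\mathcal{A}$ is unital and the unitalization of $\mathcal{A}$ otherwise, with unit $I$. A family $\{\varrho_j\}_{j=1}^n$ is a partition of unity if $\varrho_1,\dots,\varrho_{n-1}\in\mathcal{A}$, $\varrho_n\in\mathcal{A}^+$ and $\sum_{j=1}^n\varrho_j^*\varrho_j=I$. A subset $A\subset\mathcal{A}$ is $\mathcal{A}$-convex if for any $x_1,\dots,x_n\in A$ and any partition of unity $\{\varrho_j\}_{j=1}^n$ one has $\sum_{j=1}^n\varrho_j^*\,x_j\,\varrho_j\in A$. *)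

(* Defs.v *)
From HB Require Import structures.
From mathcomp Require Import all_boot all_order all_algebra.
From mathcomp Require Import complex.
From mathcomp Require Import mathcomp_extra boolp classical_sets functions.
From mathcomp Require Import reals ereal topology normedtype sequences.

Set Implicit Arguments.
Unset Strict Implicit.
Unset Printing Implicit Defensive.

Import Order.TTheory GRing.Theory Num.Theory.
Import numFieldNormedType.Exports.

Local Open Scope classical_set_scope.
Local Open Scope complex_scope.
Local Open Scope ring_scope.

Section ComplexSequences.
Variable R : realType.
Implicit Types (z w : nat -> R[i]^o).

Lemma cplx_seq_cvg z :
  (forall e : R[i], 0 < e -> exists N, forall m n,
    (N <= m)%N -> (N <= n)%N -> `|z m - z n| < e) ->
  cvg (z @ \oo).
Proof.
move=> zC.
have aux (f : {additive R[i] -> R}) : (forall x, (`|f x|%:C <= `|x|)%R) ->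
  cvg ((fun n => f (z n)) @ \oo).
  move=> fle; apply/cauchy_cvgP/cauchy_ballP/cauchy_ballP/cauchyP => e e0.
  have [|N HN] := zC e%:C; first by rewrite ltcR.
  exists (f (z N)); exists N => //= n Nn /=.
  rewrite /ball /= -ltcR -raddfB; apply: le_lt_trans (fle _) _.
  exact: HN.
have /cvg_ex[a Ha] := aux (@complex.Re R) (@normc_ge_Re R).
have /cvg_ex[b Hb] : cvg ((fun n => complex.Im (z n) : R) @ \oo).
  apply: (aux (@complex.Im R)) => -[x y]; rewrite normc_def /= lecR.
  by rewrite -sqrtr_sqr ler_sqrt ?addr_ge0 ?sqr_ge0// lerDr sqr_ge0.
apply/cvg_ex; exists (a +i* b); apply/cvgrPdist_lt => e e0.
have e2 : 0 < complex.Re e / 2.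
  by rewrite divr_gt0//; move: e0; rewrite ltcE => /andP[].
have eE : e = (complex.Re e)%:C by rewrite RRe_real// gtr0_real.
move/cvgrPdist_lt : Ha => /(_ _ e2) Ha; move/cvgrPdist_lt : Hb => /(_ _ e2) Hb.
near=> n.
have -> : (a +i* b) - z n
   = (a - complex.Re (z n))%:C + 'i%C * (b - complex.Im (z n))%:C.
  by case: (z n) => x y /=; simpc.
rewrite (le_lt_trans (ler_normD _ _))// normrM.
have -> : `|'i%C : R[i]| = 1 by rewrite normc_def /= expr0n expr1n add0r sqrtr1.
rewrite mul1r !normc_def /= !expr0n !addr0 !sqrtr_sqr eE -rmorphD ltcR.
rewrite (splitr (complex.Re e)) ltrD//; first by near: n.
by near: n.
Unshelve. all: by end_near. Qed.

Lemma cplx_lim_ge0 z (l : R[i]^o) :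
  (forall n, 0 <= z n) -> z @ \oo --> l -> 0 <= l.
Proof.
move=> z0 zl; suff -> : l = `|l| by [].
apply: (@cvg_unique _ (@norm_hausdorff _ _) (z @ \oo)) => //.
rewrite (_ : z = fun n => `|z n|); first exact: cvg_norm.
by apply/funext => n; rewrite ger0_norm.
Qed.

Lemma cplx_cvg_conj z (l : R[i]^o) : z @ \oo --> l ->
  (fun n => (z n : R[i])^* : R[i]^o) @ \oo --> ((l : R[i])^* : R[i]^o).
Proof.
move=> /cvgrPdist_lt zl; apply/cvgrPdist_lt => e e0.
near=> n; rewrite -rmorphB norm_conjC; near: n; exact: zl.
Unshelve. all: by end_near. Qed.

End ComplexSequences.
(* Inner products are conjugate linear in the first variable and linear in the
   second one. (The library forms of sesquilinear.v are linear in the first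
   variable.) Norms of complex normed modules are nonnegative elements of
   R[i]. *)
Record semi_inner (R : realType) (V : lmodType R[i]) := SemiInner {
  sip :> V -> V -> R[i] ;
  sip_linear : forall (x y z : V) (c : R[i]),
    sip x (c *: y + z) = c * sip x y + sip x z ;
  sip_conj : forall x y : V, (sip x y)^* = sip y x ;
  sip_ge0 : forall x : V, 0 <= sip x x }.

Section SemiInnerTheory.
Variables (R : realType) (V : lmodType R[i]) (s : semi_inner V).
Implicit Types (x y z : V) (c : R[i]).

Lemma sipDr x y z : s x (y + z) = s x y + s x z.
Proof. by have := sip_linear s x y z 1; rewrite scale1r mul1r. Qed.

Lemma sip0r x : s x 0 = 0.
Proof. by apply: (addrI (s x 0)); rewrite addr0 -sipDr addr0. Qed.

Lemma sipZr x y c : s x (c *: y) = c * s x y.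
Proof. by have := sip_linear s x y 0 c; rewrite addr0 sip0r addr0. Qed.

Lemma sipNr x y : s x (- y) = - s x y.
Proof. by rewrite -scaleN1r sipZr mulN1r. Qed.

Lemma sipDl x y z : s (x + y) z = s x z + s y z.
Proof. by rewrite -sip_conj sipDr rmorphD /= !sip_conj. Qed.

Lemma sipZl x y c : s (c *: x) y = c^* * s x y.
Proof. by rewrite -sip_conj sipZr rmorphM /= sip_conj. Qed.

Lemma sipNl x y : s (- x) y = - s x y.
Proof. by rewrite -sip_conj sipNr rmorphN /= sip_conj. Qed.

Lemma sip0l x : s 0 x = 0.
Proof. by rewrite -sip_conj sip0r rmorph0. Qed.

Definition sinorm x : R[i] := sqrtC (s x x).

Lemma sinorm_ge0 x : 0 <= sinorm x.
Proof. by rewrite sqrtC_ge0 sip_ge0. Qed.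

Lemma sinormK x : sinorm x ^+ 2 = s x x.
Proof. exact: sqrtCK. Qed.

Lemma sinormZ c x : sinorm (c *: x) = `|c| * sinorm x.
Proof.
rewrite /sinorm sipZr sipZl mulrA -normCK sqrtCM ?qualifE/= ?sip_ge0 ?exprn_ge0//.
congr (_ * _).
by apply/eqP; rewrite -(@eqrXn2 _ 2) ?sqrtCK ?sqrtC_ge0 ?exprn_ge0 ?normr_ge0.
Qed.

Lemma sinormN x : sinorm (- x) = sinorm x.
Proof. by rewrite /sinorm sipNl sipNr opprK. Qed.

Lemma sinormB x y : sinorm (x - y) = sinorm (y - x).
Proof. by rewrite -sinormN opprB. Qed.

Lemma sinorm0 : sinorm 0 = 0.
Proof. by rewrite /sinorm sip0r sqrtC0. Qed.

Lemma CauchySchwarz_sip x y : `|s x y| <= sinorm x * sinorm y.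
Proof.
rewrite -(@ler_pXn2r _ 2)// ?qualifE/= ?mulr_ge0 ?sinorm_ge0//.
rewrite exprMn !sinormK.
set c := s x y; set a := s x x; set b := s y y.
have a0 : 0 <= a by exact: sip_ge0.
have b0 : 0 <= b by exact: sip_ge0.
have key t : 0 <= a - (t * c + (t * c)^*) + `|t| ^+ 2 * b.
  have := sip_ge0 s (x - t *: y).
  rewrite sipDl !sipDr !sipNl !sipNr !sipZl !sipZr opprK.
  rewrite -/a -/b -/c -[s y x]sip_conj -/c normCK rmorphM /=.
  by congr (0 <= _); rewrite opprD !addrA; congr (_ + _); rewrite mulrCA mulrA.
have [b_eq0|bn0] := eqVneq b 0.
  have [->|cn0] := eqVneq c 0; first by rewrite normr0 expr0n/= mulr_ge0.
  have nc0 : `|c| ^+ 2 != 0 by rewrite expf_neq0// normr_eq0.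
  have := key ((a + 1) / `|c| ^+ 2 * c^*).
  rewrite b_eq0 mulr0 addr0 -mulrA [c^* * c]mulrC -normCK divfK//.
  have -> : (a + 1)^* = a + 1 by rewrite geC0_conj// addr_ge0.
  have -> : a - (a + 1 + (a + 1)) = - (1 + (a + 1)).
    by rewrite !opprD !addrA subrr add0r.
  move=> h.
  have : 0 < 1 + (a + 1) by rewrite ltr_wpDr ?addr_ge0.
  by rewrite -oppr_lt0 => /(le_lt_trans h); rewrite ltxx.
have bp : 0 < b by rewrite lt_def bn0.
have := key (c^* / b).
have -> : c^* / b * c = `|c| ^+ 2 / b by rewrite mulrAC [c^* * c]mulrC -normCK.
have -> : (`|c| ^+ 2 / b)^* = `|c| ^+ 2 / b.
  by rewrite geC0_conj// divr_ge0// exprn_ge0.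
have -> : `|c^* / b| ^+ 2 * b = `|c| ^+ 2 / b.
  rewrite normrM norm_conjC normfV (ger0_norm b0) exprMn -mulrA; congr (_ * _).
  by rewrite expr2 -mulrA mulVf// mulr1.
by rewrite opprD addrA subrK subr_ge0 ler_pdivrMr.
Qed.

Lemma ler_sinormD x y : sinorm (x + y) <= sinorm x + sinorm y.
Proof.
rewrite -(@ler_pXn2r _ 2)// ?qualifE/= ?addr_ge0 ?sinorm_ge0//.
rewrite sqrrD !sinormK sipDl !sipDr.
rewrite addrA lerD2r -addrA lerD2l -(sip_conj _ x y).
set c := s x y.
rewrite [leLHS]addcJ -[leRHS]mulr_natl ler_pM2l ?ltr0n//.
apply: le_trans (CauchySchwarz_sip x y); apply: le_trans (normc_ge_Re c).
by rewrite lecR ler_norm.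
Qed.

Lemma ler_sinorm_dist x y z : sinorm (x - z) <= sinorm (x - y) + sinorm (y - z).
Proof. by have := ler_sinormD (x - y) (y - z); rewrite addrA subrK. Qed.

End SemiInnerTheory.

Section Completion.
Variables (R : realType) (V : lmodType R[i]) (s : semi_inner V).

(* The Hilbert space completion of V / {x | s x x = 0}: Cauchy sequences of V
   for the seminorm of s, modulo the sequences tending to 0 in that seminorm.
   The quotient by {x | s x x = 0} and the completion are done in one step; see
   cdot_to_completion, to_completion_eq0 and dense_to_completion below. *)
Definition sip_cauchy (u : nat -> V) := forall e : R[i], 0 < e ->
  exists N, forall m n, (N <= m)%N -> (N <= n)%N -> sinorm s (u m - u n) < e.

Definition sip_null (u : nat -> V) := forall e : R[i], 0 < e ->
  exists N, forall n, (N <= n)%N -> sinorm s (u n) < e.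

Definition cauchy_pred : pred (nat -> V) := fun u => `[< sip_cauchy u >].

Fact cauchy_pred_submod : GRing.subsemimod_closed cauchy_pred.
Proof.
split; first split.
- apply/asboolP => e e0; exists 0%N => m n _ _.
  by rewrite subrr sinorm0.
- move=> u v /asboolP uc /asboolP vc; apply/asboolP => e e0.
  have e2 : 0 < e / 2 by rewrite divr_gt0.
  have [N HN] := uc _ e2; have [M HM] := vc _ e2.
  exists (maxn N M) => m n; rewrite !geq_max => /andP[Nm Mm] /andP[Nn Mn].
  rewrite [(u + v) m]/(u m + v m) [(u + v) n]/(u n + v n) opprD addrACA.
  rewrite (le_lt_trans (ler_sinormD _ _ _))// (splitr e) ltrD//.
    exact: HN.
  exact: HM.
- move=> c u /asboolP uc; apply/asboolP => e e0.
  have c1 : 0 < `|c| + 1 by rewrite ltr_wpDl.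
  have [|N HN] := uc (e / (`|c| + 1)); first by rewrite divr_gt0.
  exists N => m n Nm Nn; rewrite [(c *: u) m]/(c *: u m) [(c *: u) n]/(c *: u n).
  rewrite -scalerBr sinormZ.
  rewrite (@le_lt_trans _ _ ((`|c| + 1) * sinorm s (u m - u n)))//.
    by rewrite ler_wpM2r ?sinorm_ge0// lerDl.
  by rewrite mulrC -ltr_pdivlMr// HN.
Qed.

HB.instance Definition _ :=
  GRing.isSubmodClosed.Build R[i] (nat -> V) cauchy_pred cauchy_pred_submod.

Record cauchyseq := CauchySeq {
  cseq :> nat -> V ; cseqP : cseq \in cauchy_pred }.

HB.instance Definition _ := [isSub for cseq].
HB.instance Definition _ := [Choice of cauchyseq by <:].
HB.instance Definition _ := [SubChoice_isSubLmodule of cauchyseq by <:].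

Definition null_pred : pred cauchyseq := fun u => `[< sip_null u >].

Fact null_pred_submod : GRing.subsemimod_closed null_pred.
Proof.
split; first split.
- apply/asboolP => e e0; exists 0%N => n _.
  by rewrite [X in sinorm _ X](_ : _ = 0)// sinorm0.
- move=> u v /asboolP uc /asboolP vc; apply/asboolP => e e0.
  have e2 : 0 < e / 2 by rewrite divr_gt0.
  have [N HN] := uc _ e2; have [M HM] := vc _ e2.
  exists (maxn N M) => m; rewrite !geq_max => /andP[Nm Mm].
  rewrite [X in sinorm _ X](_ : _ = u m + v m)//.
  by rewrite (le_lt_trans (ler_sinormD _ _ _))// (splitr e) ltrD ?HN ?HM.
- move=> c u /asboolP uc; apply/asboolP => e e0.
  have c1 : 0 < `|c| + 1 by rewrite ltr_wpDl.
  have [|N HN] := uc (e / (`|c| + 1)); first by rewrite divr_gt0.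
  exists N => m Nm; rewrite [X in sinorm _ X](_ : _ = c *: u m)// sinormZ.
  rewrite (@le_lt_trans _ _ ((`|c| + 1) * sinorm s (u m)))//.
    by rewrite ler_wpM2r ?sinorm_ge0// lerDl.
  by rewrite mulrC -ltr_pdivlMr// HN.
Qed.

HB.instance Definition _ :=
  GRing.isSubmodClosed.Build R[i] cauchyseq null_pred null_pred_submod.

Local Open Scope quotient_scope.

Definition completion : Type := 
  Quotient.quot (GRing.ZmodClosed.clone cauchyseq null_pred _).

HB.instance Definition _ := GRing.Zmodule.on completion.

Definition cls (u : cauchyseq) : completion := \pi u.

Lemma cls_surj (p : completion) : exists u, p = cls u.
Proof. by exists (repr p); rewrite /cls reprK. Qed.

Lemma clsD (u v : cauchyseq) : cls (u + v) = cls u + cls v.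
Proof. by rewrite /cls raddfD. Qed.

Lemma cls_eqP (u v : cauchyseq) : reflect (sip_null (u - v)) (cls u == cls v).
Proof. by rewrite /cls -Quotient.idealrBE; exact: asboolP. Qed.

End Completion.

Section CompletionInner.
Variables (R : realType) (V : lmodType R[i]) (s : semi_inner V).
Implicit Types (u v w : cauchyseq s) (p q r : completion s).

Lemma null_seqZ (c : R[i]) u : sip_null s u -> sip_null s (c *: u).
Proof.
move=> /asboolP nu; apply/asboolP.
by have [_ +] := null_pred_submod s; apply.
Qed.

Definition cscale (c : R[i]) p : completion s := cls (c *: repr p).

Lemma null_repr u : sip_null s (repr (cls u) - u).
Proof. by apply/cls_eqP; rewrite /cls reprK. Qed.

Lemma cscale_cls c u : cscale c (cls u) = cls (c *: u).
Proof.
by apply/eqP/cls_eqP; rewrite -scalerBr; apply/null_seqZ/null_repr.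
Qed.

Fact cscaleA (a b : R[i]) p : cscale a (cscale b p) = cscale (a * b) p.
Proof. by have [u ->] := cls_surj p; rewrite !cscale_cls scalerA. Qed.

Fact cscale1 : left_id 1 cscale.
Proof. by move=> p; have [u ->] := cls_surj p; rewrite cscale_cls scale1r. Qed.

Fact cscaleDr : right_distributive cscale +%R.
Proof.
move=> c p q; have [u ->] := cls_surj p; have [v ->] := cls_surj q.
by rewrite -clsD !cscale_cls scalerDr clsD.
Qed.

Fact cscaleDl p : {morph cscale^~ p : a b / a + b}.
Proof.
by move=> a b; have [u ->] := cls_surj p; rewrite !cscale_cls scalerDl clsD.
Qed.

HB.instance Definition _ := GRing.Zmodule_isLmodule.Build R[i] (completion s)
  cscaleA cscale1 cscaleDr cscaleDl.

Lemma clsZ c u : cls (c *: u) = c *: cls u.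
Proof. by rewrite -cscale_cls. Qed.

Lemma clsB u v : cls (u - v) = cls u - cls v.
Proof. by rewrite clsD -scaleN1r clsZ scaleN1r. Qed.

Lemma sip_dist (a b a' b' : V) : `|s a b - s a' b'|
  <= sinorm s (a - a') * sinorm s b + sinorm s a' * sinorm s (b - b').
Proof.
have -> : s a b - s a' b' = s (a - a') b + s a' (b - b').
  by rewrite sipDl sipNl sipDr sipNr addrA subrK.
by rewrite (le_trans (ler_normD _ _))// lerD// CauchySchwarz_sip.
Qed.

Lemma cauchyseqP u : sip_cauchy s u.
Proof. by apply/asboolP; exact: cseqP. Qed.

Lemma cauchyseq_bounded u : exists N (M : R[i]),
  0 < M /\ forall n, (N <= n)%N -> sinorm s (u n) <= M.
Proof.
have [N HN] := cauchyseqP u ltr01.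
exists N, (sinorm s (u N) + 1); split; first by rewrite ltr_wpDl ?sinorm_ge0.
move=> n Nn; have := ler_sinormD s (u N) (u n - u N); rewrite subrKC => /le_trans.
by apply; rewrite lerD2l ltW// HN.
Qed.

Lemma sip_small (a b M e : R[i]) :
  0 < M -> 0 <= a -> 0 <= b -> a < e / (2 * M) -> b <= M -> a * b < e / 2.
Proof.
move=> M0 a0 b0 ae bM; apply: (@le_lt_trans _ _ (a * M)).
  by rewrite ler_wpM2l.
by rewrite -ltr_pdivlMr// -mulrA -invfM.
Qed.

Lemma sip_seq_cvg u v : cvg ((fun n => s (u n) (v n) : R[i]^o) @ \oo).
Proof.
apply: cplx_seq_cvg => e e0.
have [N1 [M1 [M10 H1]]] := cauchyseq_bounded u.
have [N2 [M2 [M20 H2]]] := cauchyseq_bounded v.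
have [|N3 H3] := cauchyseqP u (e := e / (2 * M2)).
  by rewrite divr_gt0// mulr_gt0.
have [|N4 H4] := cauchyseqP v (e := e / (2 * M1)).
  by rewrite divr_gt0// mulr_gt0.
exists (maxn (maxn N1 N2) (maxn N3 N4)) => m n; rewrite !geq_max.
move=> /andP[/andP[m1 m2] /andP[m3 m4]] /andP[/andP[n1 n2] /andP[n3 n4]].
rewrite (le_lt_trans (sip_dist _ _ _ _))// (splitr e) ltrD//.
  by apply: sip_small M20 _ _ _ _; rewrite ?sinorm_ge0 ?H2 ?H3.
by rewrite mulrC; apply: sip_small M10 _ _ _ _; rewrite ?sinorm_ge0 ?H1 ?H4.
Qed.

Definition cdot p q : R[i] :=
  lim ((fun n => s (repr p n) (repr q n) : R[i]^o) @ \oo).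

Lemma cdot_cls u v :
  (fun n => s (u n) (v n) : R[i]^o) @ \oo --> (cdot (cls u) (cls v) : R[i]^o).
Proof.
set u' := repr (cls u); set v' := repr (cls v).
have /cvgrPdist_lt h := @sip_seq_cvg u' v'.
apply/cvgrPdist_lt => e e0.
have e2 : 0 < e / 2 by rewrite divr_gt0.
have [N1 [M1 [M10 H1]]] := cauchyseq_bounded u.
have [N2 [M2 [M20 H2]]] := cauchyseq_bounded v'.
have [|N3 H3] := null_repr u (e := e / 2 / (2 * M2)).
  by rewrite divr_gt0// mulr_gt0.
have [|N4 H4] := null_repr v (e := e / 2 / (2 * M1)).
  by rewrite divr_gt0// mulr_gt0.
near=> n.
have [n1 n2 n3 n4] : [/\ (N1 <= n)%N, (N2 <= n)%N, (N3 <= n)%N & (N4 <= n)%N].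
  by split; near: n; exact: nbhs_infty_ge.
rewrite -(subrKA (s (u' n) (v' n))) (le_lt_trans (ler_normD _ _))//.
rewrite (splitr e) ltrD//; first by near: n; exact: h.
rewrite (le_lt_trans (sip_dist _ _ _ _))// (splitr (e / 2)) ltrD//.
  by apply: sip_small M20 _ _ _ _; rewrite ?sinorm_ge0 ?H2//; exact: H3.
rewrite mulrC; apply: sip_small M10 _ _ _ _; rewrite ?sinorm_ge0 ?H1//.
exact: H4.
Unshelve. all: by end_near. Qed.

Lemma cdot_unique u v (l : R[i]^o) :
  (fun n => s (u n) (v n) : R[i]^o) @ \oo --> l -> cdot (cls u) (cls v) = l.
Proof.
move=> h; have hausd := @norm_hausdorff R[i] R[i]^o.
exact: (@cvg_unique _ hausd _ _ _ _ (@cdot_cls u v) h).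
Qed.

Fact cdot_linear p q r (c : R[i]) :
  cdot p (c *: q + r) = c * cdot p q + cdot p r.
Proof.
have [u ->] := cls_surj p; have [v ->] := cls_surj q; have [w ->] := cls_surj r.
rewrite -clsZ -clsD; apply: cdot_unique.
have h := @cvgZl_tmp _ R[i]^o _ _ eventually_filter c _ _ (@cdot_cls u v).
have := @cvgD _ R[i]^o _ _ eventually_filter _ _ _ _ h (@cdot_cls u w).
set f := (X in X x @[x --> _] --> _ -> _).
have -> : f = (fun n => s (u n) ((c *: v + w : cauchyseq s) n) : R[i]^o).
  by apply/funext => n; rewrite [RHS]sip_linear.
exact.
Qed.

Fact cdot_conj p q : (cdot p q)^* = cdot q p.
Proof.
have [u ->] := cls_surj p; have [v ->] := cls_surj q.
apply/esym/cdot_unique; have := cplx_cvg_conj (@cdot_cls u v).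
by under eq_fun do rewrite sip_conj.
Qed.

Fact cdot_ge0 p : 0 <= cdot p p.
Proof.
have [u ->] := cls_surj p.
by apply: cplx_lim_ge0 (@cdot_cls u u) => n; exact: sip_ge0.
Qed.

Definition cdot_sip := SemiInner cdot_linear cdot_conj cdot_ge0.

Fact cdot_eq0 p : sinorm cdot_sip p = 0 -> p = 0.
Proof.
move=> /eqP; rewrite sqrtC_eq0 => /eqP; have [u ->] := cls_surj p => /= h.
have {h} : (fun n => s (u n) (u n) : R[i]^o) @ \oo --> (0 : R[i]^o).
  by rewrite -[X in _ --> X]h; exact: cdot_cls.
move=> /cvgrPdist_lt h; apply/eqP.
have -> : 0 = cls (0 : cauchyseq s) by rewrite -(subrr (0 : cauchyseq s)) clsB subrr.
apply/cls_eqP; rewrite subr0 => e e0.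
have [|N _ HN] := h (e ^+ 2); first by rewrite exprn_gt0.
exists N => n Nn; have := HN n Nn.
rewrite /= sub0r normrN ger0_norm ?sip_ge0// -sinormK.
by rewrite ltr_pXn2r// qualifE/= ?sinorm_ge0 ?ltW.
Qed.

HB.instance Definition _ := Lmodule_isNormed.Build R[i] (completion s)
  (@ler_sinormD _ _ cdot_sip) (@sinormZ _ _ cdot_sip) cdot_eq0.

Lemma completion_normE p : `|p| = sinorm cdot_sip p.
Proof. by []. Qed.

End CompletionInner.

HB.mixin Record isHilbertSpace (R : realType) H
    of CompleteNormedModule R[i] H := {
  hdot : H -> H -> R[i] ;
  hdot_linear : forall (x y z : H) (c : R[i]),
    hdot x (c *: y + z) = c * hdot x y + hdot x z ;
  hdot_conj : forall x y : H, (hdot x y)^* = hdot y x ;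
  hdot_norm : forall x : H, `|x| ^+ 2 = hdot x x }.

#[short(type="hilbertType")]
HB.structure Definition HilbertSpace (R : realType) :=
  {H of CompleteNormedModule R[i] H & isHilbertSpace R H}.

Definition orthocomp (R : realType) (H : hilbertType R) (S : set H) : set H :=
  [set v | forall u, S u -> hdot u v = 0].

Section CompletionComplete.
Variables (R : realType) (V : lmodType R[i]) (s : semi_inner V).
Implicit Types (u v w : cauchyseq s) (p q r : completion s).

Fact const_cauchy (x : V) : (fun=> x) \in cauchy_pred s.
Proof.
by apply/asboolP => e e0; exists 0%N => m n _ _; rewrite subrr sinorm0.
Qed.

Definition to_completion (x : V) : completion s :=
  cls (CauchySeq (const_cauchy x)).

Lemma cdot_to_completion (x y : V) :
  cdot (to_completion x) (to_completion y) = s x y.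
Proof.
rewrite /to_completion.
apply: (@cdot_unique _ _ s (CauchySeq (const_cauchy x))
  (CauchySeq (const_cauchy y)) (s x y)) => /=.
apply: (@cvg_cst R[i]^o (s x y : R[i]^o)).
Qed.

Fact to_completion_linear : linear to_completion.
Proof.
move=> c x y; rewrite /to_completion -clsZ -clsD; apply/eqP/cls_eqP.
move=> e e0; exists 0%N => n _.
by rewrite [X in sinorm _ X](_ : _ = (c *: x + y) - (c *: x + y))// subrr sinorm0.
Qed.

HB.instance Definition _ := GRing.isLinear.Build R[i] V (completion s) _
  to_completion to_completion_linear.

Lemma norm_to_completion (x : V) : `|to_completion x| = sinorm s x.
Proof. by rewrite completion_normE /sinorm /= cdot_to_completion. Qed.

Lemma norm_cls_le u (M : R[i]) : 0 <= M ->
  (exists N, forall n, (N <= n)%N -> sinorm s (u n) <= M) -> `|cls u| <= M.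
Proof.
move=> M0 [N HN]; rewrite completion_normE.
rewrite -(@ler_pXn2r _ 2)// ?qualifE/= ?sinorm_ge0// sinormK /=.
rewrite -subr_ge0.
have := @cdot_cls _ _ _ u u; rewrite -(cvg_shiftn N) => h.
have := @cvgB _ R[i]^o _ _ eventually_filter _ _ _ _
  (@cvg_cst _ (M ^+ 2 : R[i]^o) _ _ eventually_filter) h.
apply: cplx_lim_ge0 => n.
rewrite [X in 0 <= X](_ : _ = M ^+ 2 - s (u (n + N)%N) (u (n + N)%N))//.
rewrite subr_ge0 -sinormK ler_pXn2r ?qualifE/= ?sinorm_ge0//.
by apply: HN; rewrite leq_addl.
Qed.

Lemma dense_to_completion : dense (range to_completion).
Proof.
move=> O [p Op] oO; have [u pE] := cls_surj p; subst p.
have := open_nbhs_nbhs (conj oO Op); rewrite -nbhs_ballE => -[e /= e0 eO].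
have e2 : 0 < e / 2 by rewrite divr_gt0.
have [N HN] := cauchyseqP u e2.
exists (to_completion (u N)); split; last by exists (u N).
apply: eO; rewrite -ball_normE /= -clsB.
apply: (@le_lt_trans _ _ (e / 2)); last by rewrite ltr_pdivrMr// ltr_pMr// ltr1n.
apply: norm_cls_le; first exact: ltW.
by exists N => n Nn; apply/ltW; exact: HN.
Qed.

Lemma cplx_natSinv_lt (e : R[i]) : 0 < e ->
  exists N, forall n, (N <= n)%N -> n.+1%:R^-1 < e.
Proof.
move=> e0; have eE : e = (complex.Re e)%:C by rewrite RRe_real// gtr0_real.
have e1 : 0 < complex.Re e by rewrite -ltcR -eE.
have [N _ HN] := near_infty_natSinv_lt (PosNum e1).
exists N => n /HN /=; rewrite -ltcR -eE; congr (_ < _).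
by rewrite fmorphV rmorph_nat.
Qed.

Lemma completion_complete (F : set_system (completion s)) :
  ProperFilter F -> cauchy F -> cvg F.
Proof.
move=> FF /cauchy_ballP/cauchy_ballP/cauchyP Fc.
have pos n : 0 < (n.+1%:R^-1 : R[i]) by rewrite invr_gt0 ltr0n.
have /choice[f Hf] n : exists x : V, F (ball (to_completion x) n.+1%:R^-1).
  have e2 : 0 < (n.+1%:R^-1 : R[i]) / 2 by rewrite divr_gt0.
  have [q Fq] := Fc _ e2.
  have [||y [/= qx [x _ xE]]] := @dense_to_completion (ball q (n.+1%:R^-1 / 2))°.
  - by exists q; exact: nbhsx_ballx.
  - exact: open_interior.
  move: qx; rewrite -xE => qx; exists x; apply: filterS Fq => r qr.
  rewrite (splitr n.+1%:R^-1); apply: ball_triangle qr.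
  by apply: ball_sym; exact: interior_subset qx.
have fc : f \in cauchy_pred s.
  apply/asboolP => e e0.
  have [|N HN] := @cplx_natSinv_lt (e / 2); first by rewrite divr_gt0.
  exists N => m n Nm Nn.
  have [q [qm qn]] := @filter_ex _ _ FF _ (filterI (Hf m) (Hf n)).
  rewrite -norm_to_completion raddfB /=.
  rewrite -(subrKA q) (le_lt_trans (ler_normD _ _))// (splitr e).
  rewrite ltrD//; first by apply: lt_trans (HN _ Nm); rewrite -ball_normE in qm.
  by rewrite distrC; apply: lt_trans (HN _ Nn); rewrite -ball_normE in qn.
apply/cvg_ex; exists (cls (CauchySeq fc)).
move=> A; rewrite -nbhs_ballE => -[e /= e0 eA].
have [|N HN] := @cplx_natSinv_lt (e / 2); first by rewrite divr_gt0.
have [|M HM] := @cauchyseqP _ _ _ (CauchySeq fc) (e / 2); first by rewrite divr_gt0.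
apply: filterS (Hf (maxn N M)) => q; rewrite -ball_normE /= => qf.
apply: eA; rewrite -ball_normE /=.
rewrite -(subrKA (to_completion (f (maxn N M)))) (le_lt_trans (ler_normD _ _))//.
rewrite (splitr e) ler_ltD//; last first.
  by apply: lt_trans qf _; exact: HN (leq_maxl _ _).
rewrite -clsB; apply: norm_cls_le; first by rewrite ltW ?divr_gt0.
by exists M => n Mn; apply/ltW; apply: HM; rewrite // leq_maxr.
Qed.

HB.instance Definition _ :=
  Uniform_isComplete.Build (completion s) completion_complete.

Fact completion_hdot_norm p : `|p| ^+ 2 = cdot p p.
Proof. by rewrite completion_normE sinormK. Qed.

HB.instance Definition _ := isHilbertSpace.Build R (completion s)
  (@cdot_linear _ _ s) (@cdot_conj _ _ s) completion_hdot_norm.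

End CompletionComplete.

Lemma to_completion_eq0 (R : realType) (V : lmodType R[i]) (s : semi_inner V)
  (x : V) : to_completion s x = 0 <-> s x x = 0.
Proof.
rewrite -sinormK; split=> [x0|/eqP].
  by rewrite -norm_to_completion x0 normr0 expr0n.
by rewrite sqrf_eq0 -norm_to_completion normr_eq0 => /eqP.
Qed.

(* Not necessarily unital: the operations of the algebra are therefore not
   those of a MathComp ring. *)
HB.mixin Record isCStarAlgebra (R : realType) A
    of CompleteNormedModule R[i] A := {
  cmul : A -> A -> A ;
  star : A -> A ;
  cmulA : associative cmul ;
  cmulDl : left_distributive cmul +%R ;
  cmulDr : right_distributive cmul +%R ;
  cmulZl : forall (l : R[i]) (a b : A), cmul (l *: a) b = l *: cmul a b ;
  cmulZr : forall (l : R[i]) (a b : A), cmul a (l *: b) = l *: cmul a b ;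
  starK : involutive star ;
  starD : {morph star : a b / a + b} ;
  starZ : forall (l : R[i]) (a : A), star (l *: a) = l^* *: star a ;
  starM : forall a b : A, star (cmul a b) = cmul (star b) (star a) ;
  cmul_norm : forall a b : A, `|cmul a b| <= `|a| * `|b| ;
  star_norm : forall a : A, `|cmul (star a) a| = `|a| ^+ 2 }.

#[short(type="cstarAlgType")]
HB.structure Definition CStarAlgebra (R : realType) :=
  {A of CompleteNormedModule R[i] A & isCStarAlgebra R A}.

Declare Scope cstar_scope.
Delimit Scope cstar_scope with cstar.
Local Open Scope cstar_scope.
Notation "a ** b" := (cmul a b) (at level 40, left associativity) : cstar_scope.

Definition positive_cone (R : realType) (A : cstarAlgType R) : set A :=
  [set a | exists b : A, a = star b ** b].
Arguments positive_cone {R A}.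

(* The norm of the complete normed module E is required to be the one given by
   the inner product (ip_norm); definiteness of ip follows from it. *)
HB.mixin Record isHilbertModule (R : realType) (A : cstarAlgType R) E
    of CompleteNormedModule R[i] E := {
  ract : E -> A -> E ;
  ip : E -> E -> A ;
  ractDl : forall (x y : E) (a : A), ract (x + y) a = ract x a + ract y a ;
  ractDr : forall (x : E) (a b : A), ract x (a + b) = ract x a + ract x b ;
  ractZl : forall (l : R[i]) (x : E) (a : A), ract (l *: x) a = l *: ract x a ;
  ractZr : forall (l : R[i]) (x : E) (a : A), ract x (l *: a) = l *: ract x a ;
  ractA : forall (x : E) (a b : A), ract (ract x a) b = ract x (a ** b) ;
  ip_linear : forall (x y z : E) (l : R[i]),
    ip x (l *: y + z) = l *: ip x y + ip x z ;
  ip_ract : forall (x y : E) (a : A), ip x (ract y a) = ip x y ** a ;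
  ip_star : forall x y : E, star (ip x y) = ip y x ;
  ip_ge0 : forall x : E, positive_cone (ip x x) ;
  ip_norm : forall x : E, `|x| ^+ 2 = `|ip x x| }.

#[short(type="hilbertModType")]
HB.structure Definition HilbertModule (R : realType) (A : cstarAlgType R) :=
  {E of CompleteNormedModule R[i] E & isHilbertModule R A E}.

(* As A may have no unit, stability under complex scalars is listed apart. *)
Definition is_submodule (R : realType) (A : cstarAlgType R)
    (E : hilbertModType A) (L : set E) : Prop :=
  [/\ L 0,
      forall (l : R[i]) (x y : E), L x -> L y -> L (l *: x + y) &
      forall (x : E) (a : A), L x -> L (ract x a)].

Section States.
Variables (R : realType) (A : cstarAlgType R).

(* Not taken with sup, whose value on unbounded sets is 0. *)
Definition functional_norm (f : A -> R[i]) : \bar R :=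
  ereal_sup [set (complex.Re `|f a|)%:E | a in [set a : A | `|a| <= 1]].

Record state := State {
  state_fun :> {linear A -> R[i]^o} ;
  state_ge0 : forall a : A, positive_cone a -> 0 <= state_fun a :> R[i] ;
  state_norm1 : functional_norm state_fun = 1%E }.

(* Extreme points of the convex set of states. *)
Definition pure_state (w : state) : Prop :=
  forall (phi psi : state) (t : R), 0 < t < 1 ->
    (forall a, w a = t%:C * phi a + (1 - t)%:C * psi a) ->
    phi =1 w /\ psi =1 w.

End States.

Section Localization.
Variables (R : realType) (A : cstarAlgType R) (w : state A).
Variable (E : hilbertModType A).
Implicit Types x y z : E.

Definition state_ip x y : R[i] := w (ip x y).

Fact state_ip_linear x y z (c : R[i]) :
  state_ip x (c *: y + z) = c * state_ip x y + state_ip x z.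
Proof. by rewrite /state_ip ip_linear linearP. Qed.

Fact state_ip_ge0 x : 0 <= state_ip x x.
Proof. exact/state_ge0/ip_ge0. Qed.

Fact state_ip_conj x y : (state_ip x y)^* = state_ip y x.
Proof.
have addl u v z : state_ip (u + v) z = state_ip u z + state_ip v z.
  rewrite /state_ip -ip_star -[X in X + v]scale1r ip_linear scale1r starD !ip_star.
  by rewrite raddfD.
have scalel u z (c : R[i]) : state_ip (c *: u) z = c^* * state_ip u z.
  rewrite /state_ip -ip_star -[X in ip z X]addr0 ip_linear.
  have -> : ip z 0 = 0 :> A.
    by have := ip_linear z z z (-1); rewrite !scaleN1r !addNr.
  by rewrite addr0 starZ ip_star linearZ.
have addr u v z : state_ip z (u + v) = state_ip z u + state_ip z v.
  by rewrite -[u in LHS]scale1r state_ip_linear mul1r.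
have scaler u z (c : R[i]) : state_ip z (c *: u) = c * state_ip z u.
  by rewrite /state_ip -[c *: u]addr0 ip_linear; have := ip_linear z z z (-1);
     rewrite !scaleN1r !addNr => ->; rewrite addr0 linearZ.
have real u v : (state_ip u v + state_ip v u)^* = state_ip u v + state_ip v u.
  have := state_ip_ge0 (u + v); rewrite addl !addr => /geC0_conj.
  rewrite !rmorphD /= ?(geC0_conj (state_ip_ge0 _)) => h.
  apply: (addrI (state_ip u u)); apply: (addIr (state_ip v v)).
  by move: h; rewrite !addrA.
have := real x y; have := real x ('i *: y).
rewrite scaler scalel conjCi !rmorphD !rmorphM /= rmorphN /= conjCi.
rewrite opprK !mulNr -mulrN -mulrBr -mulrDr.
move=> /(mulfI (neq0Ci _)) h1 h2.
have half (C : numClosedFieldType) (a b c d : C) :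
    - a + b = c - d -> a + b = c + d -> a = d.
  move=> k1 k2; have E1 : (a + b) - (- a + b) = a *+ 2.
    by rewrite opprD opprK addrACA (subrr b) addr0 mulr2n.
  move: E1; rewrite k1 k2 opprB [LHS]addrC addrA subrK -mulr2n.
  by move=> /eqP; rewrite eqr_pMn2r// => /eqP.
exact: half h1 h2.
Qed.

Definition state_sip : semi_inner E :=
  SemiInner state_ip_linear state_ip_conj state_ip_ge0.

Definition localization : hilbertType R := completion state_sip.

Definition iota_loc : E -> localization := to_completion state_sip.

End Localization.
Arguments iota_loc {R A} w {E}.

Section Unitization.
Variables (R : realType) (A : cstarAlgType R).
Implicit Types (x y z : A * R[i]).

Definition unital : Prop := exists e : A, forall a, e ** a = a /\ a ** e = a.

Definition umul x y : A * R[i] :=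
  (x.1 ** y.1 + x.2 *: y.1 + y.2 *: x.1, x.2 * y.2).

Definition ustar x : A * R[i] := (star x.1, x.2^*).

Definition uinj (a : A) : A * R[i] := (a, 0).

(* A^+ is realised inside the algebra A * R[i] with product umul and involution
   ustar: it is the image of A by uinj if A is unital, and the whole of
   A * R[i] otherwise. Its unit is thus not always (0, 1). *)
Definition Aplus : set (A * R[i]) := [set z | unital -> range uinj z].

Definition is_unit_of_Aplus (I : A * R[i]) : Prop :=
  Aplus I /\ forall z, Aplus z -> umul I z = z /\ umul z I = z.

Definition partition_of_unity (n : nat) (rho : 'I_n.+1 -> A * R[i]) : Prop :=
  [/\ forall j, j != ord_max -> range uinj (rho j),
      Aplus (rho ord_max) &
      is_unit_of_Aplus (\sum_j umul (ustar (rho j)) (rho j))].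

Definition A_convex (X : set A) : Prop :=
  forall (n : nat) (x : 'I_n.+1 -> A) (rho : 'I_n.+1 -> A * R[i]),
    (forall j, X (x j)) -> partition_of_unity rho ->
    (uinj @` X) (\sum_j umul (umul (ustar (rho j)) (uinj (x j))) (rho j)).

End Unitization.

Section Separation.
Variables (R : realType) (A : cstarAlgType R).

Definition submodule_separation : Prop :=
  forall (E : hilbertModType A) (L : set E), closed L -> is_submodule L ->
    (forall x0, ~ L x0 -> exists2 w : state A,
       pure_state w & ~ closure (iota_loc w @` L) (iota_loc w x0)) /\
    (L <> setT -> exists2 w : state A,
       pure_state w & ~ dense (iota_loc w @` L) /\
                      orthocomp (iota_loc w @` L) <> [set 0]).

Definition convex_separation : Prop :=
  forall X : set A, X !=set0 -> closed X -> X `<=` positive_cone ->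
    A_convex X -> ~ X 0 ->
    exists2 eps : R, 0 < eps & exists2 w : state A,
      pure_state w & forall a, X a -> eps%:C <= w a :> R[i].

End Separation.

(* Main.v *)
Require Import Defs.
From HB Require Import structures.
From mathcomp Require Import all_boot all_order all_algebra.
From mathcomp Require Import complex ring lra.
From mathcomp Require Import boolp classical_sets reals ereal topology normedtype.
From mathcomp Require Import sequences.

Set Implicit Arguments.
Unset Strict Implicit.
Unset Printing Implicit Defensive.
Import Order.TTheory GRing.Theory Num.Theory.
Import numFieldNormedType.Exports.
Local Open Scope classical_set_scope.
Local Open Scope complex_scope.
Local Open Scope ring_scope.
Local Open Scope cstar_scope.

(** A pure state of a commutative C*-algebra is obtained here as a character,
    and characters come from an order-theoretic Positivstellensatz in place of
    the Gelfand transform, so that neither a spectrum nor complex analysis is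
    needed.

    Everything takes place in the commutative ring U = A x C with the
    multiplication of the unitization.  An element of U acts on A by
    multiplication, and the bounds of this action replace the C*-norm of the
    unitization.  The C*-identity gives |u| <= |u^2 + v^2|^(1/2) for
    self-adjoint u and v, and the contraction principle in A gives square
    roots of 1 - y when |y| < 1.  With these two facts the elements x such that
    |r - x| <= r for some r >= 0 form a closed convex cone, stable under
    products ([posM]), in which every x + d with d > 0 is an invertible square
    ([pos_sqrtD]) and whose trace on A is the set of all b^* b
    ([positive_coneP]).

    A set of self-adjoint elements that contains this cone P, is stable under
    sums and under multiplication by P, and does not contain -1, lies in a
    maximal one N by Zorn's lemma.  As p + d is invertible in P for p in P and
    d > 0, such an N contains x or -x for each self-adjoint x, and
    x |-> sup {r | x - r in N} is then a character that is nonnegative on N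
    ([character_exists]).  A character w that does not vanish on A is a
    pure state: if phi is a state with k phi <= w for some k > 0, then phi
    vanishes on the kernel of w, hence is proportional to w, and equal to w
    since both have norm 1 ([char_state_pure]).

    For (b), let e > 0 be smaller than the norms of the elements of the convex
    set X, let a0 be in X, and consider the set of all
    p + p0 (a0 - e) + sum c_i (a_i - e) with p, p0 positive in U, c_i positive
    in A and a_i in X.  If -1 were of this form, then sum c_i + p0 would be
    bounded below, and dividing the roots of the c_i and of p0 by the root of
    this sum would give a partition of unity for which the A-convex combination
    of the a_i and a0, an element of X, has norm at most e
    ([convex_module_proper]).  Hence some character is nonnegative on this set,
    so that it is at least e on X ([commutative_convex_separation]).

    For (c), apply (b) to the set of all a that dominate, up to an arbitrarily
    small constant, some <x0 - l, x0 - l> with l in L.  It is A-convex because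
    the weighted mean y of vectors y_j satisfies
    <y, y> <= sum w_j <y_j, y_j> ([weighted_variance]), and it avoids 0 because
    L is closed.  The state obtained keeps iota(x0) at a positive distance from
    iota(L), and the orthogonal complement of iota(L) is nonzero by the
    projection theorem ([projection_exists]).  Part (a) follows from (b) and
    (c). *)

(** * Real-valued norms *)
Section RealNorm.
Variables (R : realType) (V : normedZmodType R[i]).
Implicit Types v w : V.

(** Norms of complex normed spaces take values in [R[i]]; taking the real part
    makes the decision procedures of ordered fields available. *)
Definition rnorm v : R := complex.Re `|v|.

Lemma rnormE v : `|v| = (rnorm v)%:C.
Proof. by rewrite /rnorm RRe_real// ger0_real. Qed.

Lemma rnorm_ge0 v : 0 <= rnorm v.
Proof. by rewrite -lecR -rnormE normr_ge0. Qed.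

Lemma rnormD v w : rnorm (v + w) <= rnorm v + rnorm w.
Proof. by rewrite -lecR rmorphD /= -!rnormE ler_normD. Qed.

Lemma rnormN v : rnorm (- v) = rnorm v.
Proof. by rewrite /rnorm normrN. Qed.

Lemma rnormB v w : rnorm (v - w) = rnorm (w - v).
Proof. by rewrite /rnorm distrC. Qed.

Lemma rnorm0 : rnorm (0 : V) = 0.
Proof. by rewrite /rnorm normr0. Qed.

Lemma rnorm_eq0 v : rnorm v = 0 -> v = 0.
Proof. by move=> v0; apply/eqP; rewrite -normr_eq0 rnormE v0. Qed.

End RealNorm.

Lemma rnormM (R : realType) (z w : R[i]) : rnorm (z * w) = rnorm z * rnorm w.
Proof. by apply: complexI; rewrite rmorphM /= -!rnormE normrM. Qed.

Lemma rnorm_conj (R : realType) (z : R[i]) : rnorm z^* = rnorm z.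
Proof. by rewrite /rnorm norm_conjC. Qed.

Lemma rnorm_real (R : realType) (r : R) : rnorm r%:C = `|r|.
Proof. by rewrite /rnorm normc_def /= expr0n addr0 sqrtr_sqr. Qed.

Lemma rnormZ (R : realType) (V : normedModType R[i]) (c : R[i]) (v : V) :
  rnorm (c *: v) = rnorm c * rnorm v.
Proof. by apply: complexI; rewrite rmorphM /= -!rnormE normrZ. Qed.

Lemma ler_addgt0 (R : realType) (C x y : R) : 0 <= C ->
  (forall d, 0 < d -> x <= y + C * d) -> x <= y.
Proof.
move=> C0 h; apply/ler_addgt0Pr => e e0.
have C1 : 0 < C + 1 by lra.
have := h (e / (C + 1)) (divr_gt0 e0 C1).
move/le_trans; apply; rewrite lerD2l mulrA ler_pdivrMr//; nra.
Qed.

Lemma ler_addgt0_small (R : realType) (C x y : R) : 0 <= C ->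
  (forall d, 0 < d <= 1 -> x <= y + C * d) -> x <= y.
Proof.
move=> C0 h; apply: (ler_addgt0 C0) => d d0.
have m0 : 0 < Num.min 1 d <= 1 by rewrite lt_min ltr01 d0 ge_min lexx.
by apply: le_trans (h _ m0) _; rewrite lerD2l ler_wpM2l// ge_min lexx orbT.
Qed.

Lemma ler_sqr_nneg (R : realType) (x y : R) : 0 <= y -> x ^+ 2 <= y ^+ 2 -> x <= y.
Proof. by move=> y0 h; nra. Qed.

Section CStarNorm.
Variables (R : realType) (A : cstarAlgType R).
Implicit Types a b : A.

Lemma rnorm_cmul a b : rnorm (a ** b) <= rnorm a * rnorm b.
Proof. by rewrite -lecR rmorphM /= -!rnormE cmul_norm. Qed.

Lemma rnorm_starM a : rnorm (star a ** a) = rnorm a ^+ 2.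
Proof. by apply: complexI; rewrite rmorphXn /= -!rnormE star_norm. Qed.

Lemma rnorm_star a : rnorm (star a) = rnorm a.
Proof.
suff h b : rnorm b <= rnorm (star b).
  by apply/eqP; rewrite eq_le h andbT -{2}(starK a) h.
have [b0|b0] := eqVneq (rnorm b) 0; first by rewrite b0 rnorm_ge0.
have := rnorm_cmul (star b) b; rewrite rnorm_starM expr2 ler_pM2r//.
by rewrite lt_def b0 rnorm_ge0.
Qed.

End CStarNorm.

(** * The algebra U = A x C *)

(** A is an ideal of its unitization, and this is the product with [b]; see
    [mul_emb].  It is locked to keep unification from seeing a sum in it. *)
HB.lock Definition act (R : realType) (A : cstarAlgType R) (x : A * R[i]) (b : A) : A :=
  x.1 ** b + x.2 *: b.

Section Unitization.
Variables (R : realType) (A : cstarAlgType R).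
Hypothesis A_comm : commutative (@cmul R A).
Implicit Types a b c : A.

Lemma cmul0r a : a ** 0 = 0.
Proof. by apply: (addrI (a ** 0)); rewrite -cmulDr !addr0. Qed.

Lemma cmul0l a : 0 ** a = 0.
Proof. by apply: (addrI (0 ** a)); rewrite -cmulDl !addr0. Qed.

Lemma star0 : star (0 : A) = 0.
Proof. by apply: (addrI (star (0 : A))); rewrite -starD !addr0. Qed.

Lemma starN a : star (- a) = - star a.
Proof. by apply: (addrI (star a)); rewrite -starD !subrr star0. Qed.

(** The alias carries commutativity as a parameter, so that the product of the
    unitization can be declared as a commutative ring. *)
Definition unitize (A_comm : commutative (@cmul R A)) : Type := (A * R[i])%type.
Local Notation U := (unitize A_comm).
Implicit Types x y z u v : U.

HB.instance Definition _ := GRing.Zmodule.on U.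

Fact umulA : associative (@umul R A : U -> U -> U).
Proof.
move=> [a k] [b l] [c m]; rewrite /umul /=; congr (_, _); last exact: mulrA.
rewrite !scalerDr !cmulDl !cmulDr !cmulZr !cmulZl !scalerA cmulA.
rewrite (mulrC m k) (mulrC m l) -!addrA; congr (_ + _).
rewrite [X in l *: (a ** c) + X = _]addrCA [LHS]addrCA.
by congr (_ + _); congr (_ + _); rewrite [LHS]addrCA.
Qed.

Fact umulC : commutative (@umul R A : U -> U -> U).
Proof.
by move=> [a k] [b l]; rewrite /umul /= A_comm mulrC -!addrA (addrC (k *: b)).
Qed.

Fact umul1 : left_id ((0, 1) : U) (@umul R A : U -> U -> U).
Proof. by move=> [a k]; rewrite /umul /= cmul0l scale1r scaler0 add0r addr0 mul1r. Qed.

Fact umulDl : left_distributive (@umul R A : U -> U -> U) +%R.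
Proof.
move=> [a k] [b l] [c m]; rewrite /umul /=; congr (_, _); last exact: mulrDl.
by rewrite /= cmulDl scalerDl scalerDr [RHS]addrACA; congr (_ + _); rewrite [RHS]addrACA.
Qed.

Fact uone_neq0 : ((0, 1) : U) != 0.
Proof. by apply/eqP => -[/eqP]; rewrite oner_eq0. Qed.

HB.instance Definition _ :=
  GRing.Zmodule_isComNzRing.Build U umulA umulC umul1 umulDl uone_neq0.

Definition cst (r : R) : U := (0, r%:C).

Fact cst_is_zmod_morphism : zmod_morphism cst.
Proof. by move=> r s; congr (_, _) => /=; rewrite ?subr0// rmorphB. Qed.

Fact cst_is_monoid_morphism : monoid_morphism cst.
Proof.
split=> // r s; congr (_, _); last by rewrite /= rmorphM.
by rewrite /= cmul0l !scaler0 !addr0.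
Qed.

HB.instance Definition _ := GRing.isZmodMorphism.Build R U cst cst_is_zmod_morphism.
HB.instance Definition _ := GRing.isMonoidMorphism.Build R U cst cst_is_monoid_morphism.

Definition imu : U := (0, 'i).

Definition adj : U -> U := @ustar R A.

Fact adj_is_zmod_morphism : zmod_morphism adj.
Proof. by move=> x y; congr (_, _) => /=; rewrite ?starD ?starN// rmorphB. Qed.

Fact adj_is_monoid_morphism : monoid_morphism adj.
Proof.
split=> [|x y]; first by congr (_, _) => /=; rewrite ?star0// rmorph1.
congr (_, _) => /=; last by rewrite rmorphM.
by rewrite !starD !starZ starM A_comm.
Qed.

HB.instance Definition _ := GRing.isZmodMorphism.Build U U adj adj_is_zmod_morphism.
HB.instance Definition _ := GRing.isMonoidMorphism.Build U U adj adj_is_monoid_morphism.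

Lemma cst_half : cst 2^-1 * 2 = 1.
Proof. by rewrite -(rmorph_nat cst) -rmorphM mulVf// rmorph1. Qed.

Lemma adjK : involutive adj.
Proof. by move=> [a k]; rewrite /adj /ustar /= starK conjCK. Qed.

Lemma adj_cst r : adj (cst r) = cst r.
Proof. by congr (_, _) => /=; rewrite ?star0// conj_Creal// complex_real. Qed.

Lemma adj_imu : adj imu = - imu.
Proof. by congr (_, _) => /=; rewrite ?star0 ?oppr0// conjCi. Qed.

Lemma imu2 : imu * imu = -1.
Proof.
congr (_, _) => /=; first by rewrite cmul0l !scaler0 !addr0 oppr0.
by rewrite -expr2 sqrCi.
Qed.

Definition emb (a : A) : U := uinj a.

Fact emb_is_zmod_morphism : zmod_morphism emb.
Proof. by move=> a b; congr (_, _); rewrite /= subr0. Qed.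

HB.instance Definition _ := GRing.isZmodMorphism.Build A U emb emb_is_zmod_morphism.

Lemma embD a b : emb (a + b) = emb a + emb b. Proof. exact: raddfD. Qed.

Lemma embN a : emb (- a) = - emb a. Proof. exact: raddfN. Qed.

Lemma embB a b : emb (a - b) = emb a - emb b. Proof. exact: raddfB. Qed.

Lemma actE (x : U) b : act x b = x.1 ** b + x.2 *: b.
Proof. by rewrite unlock. Qed.

Lemma mul_emb x b : x * emb b = emb (act x b).
Proof. by congr (_, _) => /=; rewrite ?mulr0// scale0r addr0 actE. Qed.

Lemma emb_inj : injective emb.
Proof. by move=> a b []. Qed.

Lemma embM a b : emb (a ** b) = emb a * emb b.
Proof. by rewrite mul_emb; congr emb; rewrite actE /= scale0r addr0. Qed.

Lemma emb_star a : emb (star a) = adj (emb a).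
Proof. by congr (_, _); rewrite /= rmorph0. Qed.

Lemma embZ (r : R) a : emb (r%:C *: a) = cst r * emb a.
Proof. by rewrite mul_emb; congr emb; rewrite actE /= cmul0l add0r. Qed.

Lemma actM x y b : act (x * y) b = act x (act y b).
Proof. by apply: emb_inj; rewrite -!mul_emb mulrA. Qed.

Lemma actDl x y b : act (x + y) b = act x b + act y b.
Proof. by rewrite !actE /= cmulDl scalerDl addrACA. Qed.

Lemma actDr x b c : act x (b + c) = act x b + act x c.
Proof. by rewrite !actE /= cmulDr scalerDr addrACA. Qed.

Lemma actBr x b c : act x (b - c) = act x b - act x c.
Proof.
rewrite actDr; congr (_ + _); apply: (addrI (act x c)).
by rewrite -actDr !subrr actE cmul0r scaler0 addr0.
Qed.

Lemma act_cst r b : act (cst r) b = r%:C *: b.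
Proof. by rewrite actE /= cmul0l add0r. Qed.

Lemma act_emb a b : act (emb a) b = a ** b.
Proof. by rewrite actE /= scale0r addr0. Qed.

(** A bound for the C*-seminorm on U given by the action on A and by the scalar
    part together.  The scalar part matters only if A is unital: the action is
    not faithful in that case, and U is the direct sum of A and C. *)
Definition bnd (x : U) (r : R) :=
  rnorm x.2 <= r /\ forall b, rnorm (act x b) <= r * rnorm b.

Lemma bnd_ge0 x r : bnd x r -> 0 <= r.
Proof. by case=> + _; apply: le_trans; exact: rnorm_ge0. Qed.

Lemma bndW x r s : r <= s -> bnd x r -> bnd x s.
Proof.
move=> rs [h1 h2]; split=> [|b]; first exact: le_trans rs.
by apply: le_trans (h2 b) _; rewrite ler_wpM2r ?rnorm_ge0.
Qed.

Lemma bndD x y r s : bnd x r -> bnd y s -> bnd (x + y) (r + s).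
Proof.
move=> [x1 x2] [y1 y2]; split=> [|b].
  by apply: le_trans (rnormD _ _) _; exact: lerD.
by rewrite actDl (le_trans (rnormD _ _))// mulrDl lerD.
Qed.

Lemma bndM x y r s : bnd x r -> bnd y s -> bnd (x * y) (r * s).
Proof.
move=> bx by_; have r0 := bnd_ge0 bx; case: bx by_ => [x1 x2] [y1 y2].
split=> [|b]; first by rewrite rnormM ler_pM ?rnorm_ge0.
by rewrite actM (le_trans (x2 _))// -mulrA ler_wpM2l.
Qed.

Lemma bnd_cst r : bnd (cst r) `|r|.
Proof. by split=> [|b]; rewrite ?act_cst ?rnormZ rnorm_real. Qed.

Lemma bndMcst x r s : 0 <= s -> bnd x r -> bnd (cst s * x) (s * r).
Proof. by move=> s0; apply: bndM; rewrite -{2}(ger0_norm s0); exact: bnd_cst. Qed.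

Lemma bndN x r : bnd x r -> bnd (- x) r.
Proof.
move=> bx; have := bndM (bnd_cst (-1)) bx.
by rewrite rmorphN1 mulN1r normrN1 mul1r.
Qed.

Lemma bndX x r : bnd x r -> bnd (x ^+ 2) (r ^+ 2).
Proof. by rewrite !expr2 => bx; exact: bndM. Qed.

Lemma bnd_emb a : bnd (emb a) (rnorm a).
Proof.
split=> [|b]; first by rewrite /= rnorm0 rnorm_ge0.
by rewrite act_emb rnorm_cmul.
Qed.

(** Test the action on [star a] and use the C*-identity. *)
Lemma rnorm_le_bnd a r : bnd (emb a) r -> rnorm a <= r.
Proof.
move=> ba; have r0 := bnd_ge0 ba; case: ba => _ /(_ (star a)).
rewrite act_emb A_comm rnorm_starM rnorm_star.
have := rnorm_ge0 a; rewrite le_eqVlt => /orP[/eqP <-//|a0].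
by rewrite expr2 ler_pM2r.
Qed.

Lemma ex_bnd x : exists2 r, 0 < r & bnd x r.
Proof.
exists (rnorm x.1 + rnorm x.2 + 1).
  by rewrite ltr_wpDl// addr_ge0 ?rnorm_ge0.
split=> [|b]; first by have := rnorm_ge0 x.1; lra.
rewrite actE (le_trans (rnormD _ _))// rnormZ.
have := rnorm_cmul x.1 b; have := rnorm_ge0 b; nra.
Qed.

Lemma bnd_lim (C r : R) x : 0 <= C -> (forall d, 0 < d -> bnd x (r + C * d)) -> bnd x r.
Proof.
move=> C0 h; split=> [|b]; first by apply: (ler_addgt0 C0) => d /h[].
apply: (@ler_addgt0 _ (C * rnorm b)); first by rewrite mulr_ge0 ?rnorm_ge0.
by move=> d /h[_ /(_ b)]; rewrite mulrDl mulrAC.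
Qed.

(** The C*-identity for multipliers, from |x b|^2 = |b^* (x^* x b)|. *)
Lemma bnd_adjM x r : 0 <= r -> bnd (adj x * x) (r ^+ 2) -> bnd x r.
Proof.
move=> r0 [h1 h2]; split=> [|b].
  by apply: ler_sqr_nneg => //; move: h1; rewrite rnormM rnorm_conj -expr2.
apply: ler_sqr_nneg; first by rewrite mulr_ge0 ?rnorm_ge0.
have -> : rnorm (act x b) ^+ 2 = rnorm (star b ** act (adj x * x) b).
  rewrite -rnorm_starM; congr rnorm; apply: emb_inj.
  by rewrite !embM emb_star -!mul_emb rmorphM /= emb_star; ring.
apply: le_trans (rnorm_cmul _ _) _; rewrite rnorm_star.
by have := h2 b; have := rnorm_ge0 b; nra.
Qed.

(** The elements u + iv and u - iv satisfy the C*-identity with the same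
    product u^2 + v^2, and u is their mean. *)
Lemma bnd_sqrD u v r : adj u = u -> adj v = v -> 0 <= r ->
  bnd (u ^+ 2 + v ^+ 2) (r ^+ 2) -> bnd u r.
Proof.
move=> su sv r0 h.
have hp : bnd (u + imu * v) r.
  apply: bnd_adjM => //; rewrite rmorphD rmorphM /= su sv adj_imu.
  suff -> : (u + - imu * v) * (u + imu * v) = u ^+ 2 + v ^+ 2 by [].
  by have := imu2; set w := imu => w2; ring: w2.
have hm : bnd (u - imu * v) r.
  apply: bnd_adjM => //; rewrite rmorphB rmorphM /= su sv adj_imu.
  suff -> : (u - - imu * v) * (u - imu * v) = u ^+ 2 + v ^+ 2 by [].
  by have := imu2; set w := imu => w2; ring: w2.
have := bndMcst (s := 2^-1) _ (bndD hp hm).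
rewrite (_ : cst 2^-1 * _ = u); last first.
  rewrite (_ : u + imu * v + _ = 2 * u); last by ring.
  by rewrite mulrA cst_half mul1r.
by rewrite (_ : 2^-1 * (r + r) = r); [apply; lra | lra].
Qed.

Lemma bnd_adj x r : bnd x r -> bnd (adj x) r.
Proof.
move=> [h1 h2]; have r0 := bnd_ge0 (conj h1 h2); split=> [|b].
  by rewrite rnorm_conj.
have := rnorm_ge0 (act (adj x) b); rewrite le_eqVlt => /orP[/eqP<-|p].
  by rewrite mulr_ge0// rnorm_ge0.
rewrite -(ler_pM2r p) -expr2.
have -> : rnorm (act (adj x) b) ^+ 2 = rnorm (star b ** act x (act (adj x) b)).
  rewrite -rnorm_starM; congr rnorm; apply: emb_inj.
  by rewrite !embM !emb_star -!mul_emb rmorphM /= adjK; ring.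
apply: le_trans (rnorm_cmul _ _) _; rewrite rnorm_star.
by have := h2 (act (adj x) b); have := rnorm_ge0 b; nra.
Qed.

End Unitization.

(** * Completeness *)
Section Completeness.
Variables (R : realType) (V : completeNormedModType R[i]).
Implicit Types (u : nat -> V) (l v w : V) (S : set V).

(** The closure described with real radii; see [closureP]. *)
Definition adherent S l := forall e : R, 0 < e -> exists2 v, S v & rnorm (l - v) < e.

Lemma closureP S l : closure S l <-> adherent S l.
Proof.
split=> [cl e e0|ad B /nbhs_ballP[e /= e0 eB]].
  have [|v [Sv]] := cl (ball l e%:C).
    by apply/nbhs_ballP; exists e%:C => //=; rewrite ltcR.
  by rewrite -ball_normE /= rnormE ltcR => lv; exists v.
have eE : e = (complex.Re e)%:C by rewrite RRe_real// gtr0_real.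
have [|v Sv lv] := ad (complex.Re e); first by rewrite -ltcR -eE.
by exists v; split=> //; apply: eB; rewrite -ball_normE /= rnormE eE ltcR.
Qed.

Lemma closed_adherent S l : closed S -> adherent S l -> S l.
Proof. by move=> cS /closureP; exact: cS. Qed.

Lemma adherent_closed S : (forall l, adherent S l -> S l) -> closed S.
Proof. by move=> h l /closureP; exact: h. Qed.

Lemma cauchy_limit u :
  (forall e : R, 0 < e -> exists N, forall n, (N <= n)%N -> rnorm (u n - u N) < e) ->
  exists l, forall e : R, 0 < e -> exists N, forall n, (N <= n)%N -> rnorm (u n - l) < e.
Proof.
move=> uC; have /cvg_ex[l /cvgrPdist_lt ul] : cvg (u @ \oo).
  apply/cauchy_cvgP/cauchy_ballP/cauchy_ballP/cauchyP => e e0.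
  have eE : e = (complex.Re e)%:C by rewrite RRe_real// gtr0_real.
  have [|N HN] := uC (complex.Re e); first by rewrite -ltcR -eE.
  exists (u N); exists N => //= n Nn.
  by rewrite -ball_normE /= rnormE eE ltcR rnormB HN.
exists l => e e0; have [|N _ HN] := ul e%:C; first by rewrite ltcR.
by exists N => n /HN /=; rewrite rnormE ltcR rnormB.
Qed.

Lemma geometric_small (q C e : R) : 0 <= q < 1 -> 0 <= C -> 0 < e ->
  exists n, C * q ^+ n < e.
Proof.
move=> /andP[q0 q1] C0 e0.
have e1 : 0 < e / (C + 1) by rewrite divr_gt0// ltr_wpDl.
have : `|q| < 1 by rewrite ger0_norm.
move=> /cvg_expr /cvgrPdist_lt /(_ _ e1)[n _ /(_ n)] /=.
rewrite leqnn sub0r normrN ger0_norm ?exprn_ge0// => /(_ isT).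
rewrite ltr_pdivlMr ?ltr_wpDl// => h; exists n.
by have := exprn_ge0 n q0; nra.
Qed.

(** The contraction principle for complex Banach spaces, with a real ratio. *)
Lemma contraction_fixpoint S (f : V -> V) (q : R) v0 : 0 <= q < 1 ->
  (forall l, adherent S l -> S l) -> S v0 -> (forall v, S v -> S (f v)) ->
  (forall v w, S v -> S w -> rnorm (f v - f w) <= q * rnorm (v - w)) ->
  exists2 v, S v & f v = v.
Proof.
move=> q01 Scl S0 Sf ctr; have /andP[q0 q1] := q01; have q1' : 0 < 1 - q by lra.
pose y n := iter n f v0; have Sy n : S (y n) by elim: n => //= n; exact: Sf.
pose D := rnorm (y 1%N - y 0%N) / (1 - q).
have D0 : 0 <= D by rewrite divr_ge0 ?rnorm_ge0 ?ltW.
have DE : rnorm (y 1%N - y 0%N) = D * (1 - q) by rewrite divfK// lt0r_neq0.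
have dist n k : rnorm (y (n + k)%N - y n) <= D * q ^+ n.
  elim: n => [|n IH]; last first.
    rewrite addSn /= exprS mulrCA.
    by apply: le_trans (ctr _ _ (Sy _) (Sy _)) _; rewrite ler_wpM2l.
  rewrite expr0 mulr1 add0n; elim: k => [|k IH]; first by rewrite subrr rnorm0.
  have := rnormD (f (y k) - f (y 0%N)) (y 1%N - y 0%N).
  rewrite {1}/y /= subrKA DE => /le_trans; apply.
  by have := ctr _ _ (Sy k) (Sy 0%N); nra.
have [|l yl] := @cauchy_limit y.
  move=> e e0; have [N HN] := geometric_small q01 D0 e0; exists N => n Nn.
  by apply: le_lt_trans HN; rewrite -(subnKC Nn).
have Sl : S l.
  apply: Scl => e /yl[N HN]; exists (y N) => //.
  by rewrite rnormB; exact: HN.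
exists l => //; apply/subr0_eq/rnorm_eq0/eqP; rewrite eq_le rnorm_ge0 andbT.
apply: (@ler_addgt0 _ 2) => // d d0; rewrite add0r.
have [N HN] := yl _ d0.
have := rnormD (f l - f (y N)) (y N.+1 - l); rewrite /= subrKA => /le_trans; apply.
have := ctr _ _ Sl (Sy N); rewrite (rnormB l).
have := HN N (leqnn _); have := HN N.+1 (leqnSn _) => /=.
by have := rnorm_ge0 (y N - l); nra.
Qed.

End Completeness.

(** * The positive cone *)
Section PositiveCone.
Variables (R : realType) (A : cstarAlgType R).
Hypothesis A_comm : commutative (@cmul R A).
Implicit Types a b c : A.
Local Notation U := (unitize A_comm).
Implicit Types x y z u v : U.
Local Notation cst := (cst A_comm).
Local Notation emb := (emb A_comm).
Local Notation adj := (@adj R A A_comm).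

Lemma sqrt_scalar (t r : R) : `|t| <= r -> r < 1 ->
  exists2 s : R, `|s| <= r & s = 2^-1 * (t + s ^+ 2).
Proof.
move=> tr r1; have t1 : t < 1 by have := ler_norm t; lra.
pose w := Num.sqrt (1 - t); have w0 : 0 <= w := sqrtr_ge0 _.
have w2 : w ^+ 2 = 1 - t by rewrite sqr_sqrtr// subr_ge0 ltW.
exists (1 - w); last by field: w2.
apply: le_trans tr; have -> : t = (1 - w) * (1 + w) by ring: w2.
by rewrite normrM ler_peMr// ger0_norm; lra.
Qed.

Lemma selfadj_snd x : adj x = x -> exists t, x.2 = t%:C.
Proof.
move=> /(congr1 snd) /= h; exists (complex.Re x.2); rewrite RRe_real//.
by apply/CrealP.
Qed.

Lemma selfadj_adherent (S : set A) a :
  S `<=` [set b | star b = b] -> adherent S a -> star a = a.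
Proof.
move=> SS ad; apply/subr0_eq/rnorm_eq0/eqP; rewrite eq_le rnorm_ge0 andbT.
apply: (@ler_addgt0 _ 2) => // d d0; rewrite add0r.
have [v /SS /= sv av] := ad _ d0.
rewrite (_ : star a - a = star (a - v) + (v - a)).
  have := rnormD (star (a - v)) (v - a); rewrite rnorm_star (rnormB v).
  by lra.
by rewrite starD starN sv addrA subrK.
Qed.

Lemma rnorm_act_le x r a : bnd x r -> rnorm (act x a) <= r * rnorm a.
Proof. by case=> _; apply. Qed.

(** Solve z = (y + z^2) / 2 by contraction.  The scalar part of z is fixed in
    advance by [sqrt_scalar], so that only the completeness of A is used: the
    difference of two values of the iteration lies in A, where the action of
    (z + z') / 2 contracts the norm of A. *)
Lemma one_sub_sqrt y r : adj y = y -> bnd y r -> r < 1 ->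
  exists z, [/\ adj z = z, bnd z r & (1 - z) ^+ 2 = 1 - y].
Proof.
move=> sy by_ r1; have r0 := bnd_ge0 by_.
have [t yt] := selfadj_snd sy.
have [|s sr sE] := @sqrt_scalar t r _ r1.
  by case: by_ => + _; rewrite yt rnorm_real.
pose Z a : U := emb a + cst s.
pose S := [set a | star a = a /\ bnd (Z a) r].
(* The component in A of (y + z ^+ 2) / 2, for z = emb a + cst s. *)
pose f a := 2^-1%:C *: (y.1 + act (emb a + cst (2 * s)) a).
have yE : y = emb y.1 + cst t.
  by rewrite [LHS]surjective_pairing yt; congr (_, _); rewrite /= ?addr0 ?add0r.
have Zf a : Z (f a) = cst 2^-1 * (y + Z a ^+ 2).
  rewrite /Z /f embZ raddfD /= -mul_emb [in RHS]yE.
  have -> : cst 2^-1 * (emb y.1 + (emb a + cst (2 * s)) * emb a) + cst s =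
    cst 2^-1 * (emb y.1 + (emb a + cst (2 * s)) * emb a) + cst (2^-1 * (t + s ^+ 2)).
    by rewrite -sE.
  by ring.
have ZB (b c : A) : emb (b - c) = Z b - Z c by rewrite /Z raddfB /=; ring.
have half1 := cst_half A_comm.
have r01 : 0 <= r < 1 by rewrite r0.
have sZ a : star a = a -> adj (Z a) = Z a.
  by move=> sa; rewrite rmorphD /= -emb_star sa adj_cst.
have [||||a [sa ba] aE] := @contraction_fixpoint _ _ S f r 0 r01.
- move=> l ad; split; first by apply: selfadj_adherent ad => v [].
  apply: (@bnd_lim _ _ _ 1) => // d d0; have [v [_ bv] lv] := ad d d0.
  rewrite (_ : Z l = Z v + emb (l - v)); last by rewrite /Z raddfB /=; ring.
  by rewrite mul1r; apply: bndD => //; apply: bndW (bnd_emb _ _); exact: ltW.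
- split; first exact: star0.
  rewrite /Z raddf0 add0r; apply: bndW sr _; exact: bnd_cst.
- move=> a [sa ba]; split.
    apply: (@emb_inj _ _ A_comm); rewrite emb_star.
    have -> : emb (f a) = Z (f a) - cst s by rewrite /Z addrK.
    by rewrite Zf rmorphB rmorphM rmorphD rmorphXn /= !adj_cst sZ// sy.
  rewrite Zf; apply: (@bndW _ _ _ _ (2^-1 * (r + r ^+ 2))); first by nra.
  by apply: bndMcst; [lra | apply: bndD => //; exact: bndX].
- move=> v w [_ bv] [_ bw].
  have -> : f v - f w = act (cst 2^-1 * (Z v + Z w)) (v - w).
    apply: (@emb_inj _ _ A_comm); rewrite -mul_emb !ZB !Zf; ring.
  apply: rnorm_act_le; rewrite (_ : r = 2^-1 * (r + r)); last by lra.
  by apply: bndMcst; [lra | exact: bndD].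
exists (Z a); split; [exact: sZ | by [] |].
have : Z a = cst 2^-1 * (y + Z a ^+ 2) by rewrite -Zf aE.
move=> h; have {}h : 2 * Z a = y + Z a ^+ 2.
  by rewrite {1}h mulrA (mulrC 2 (cst _)) half1 mul1r.
by rewrite sqrrB expr1n mul1r -mulr_natl h; ring.
Qed.

(** The Neumann series, as the fixed point of w = 1 + z w with the scalar part
    of w already equal to that of the inverse. *)
Lemma one_sub_inv z r : bnd z r -> r < 1 -> exists w, (1 - z) * w = 1.
Proof.
move=> bz r1; have r0 := bnd_ge0 bz.
have t1 : 1 - z.2 != 0.
  apply/eqP => /subr0_eq t1; case: bz => + _.
  by rewrite -t1 /rnorm normr1 /= leNgt r1.
pose W a : U := (a, (1 - z.2)^-1).
pose f a := act z a + (1 - z.2)^-1 *: z.1.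
have Wf a : W (f a) = 1 + z * W a.
  congr (_, _); rewrite /= ?add0r /f ?actE//.
  by have := mulfV t1; rewrite mulrBl mul1r => /eqP; rewrite subr_eq => /eqP.
have r01 : 0 <= r < 1 by rewrite r0.
have [|a _ aE] := @contraction_fixpoint _ _ setT f r 0 r01 (fun _ _ => I) I (fun _ _ => I).
  move=> v w _ _; rewrite /f opprD addrACA subrr addr0 -actBr.
  exact: rnorm_act_le.
exists (W a); have := Wf a; rewrite aE => h.
by rewrite mulrBl mul1r {1}h addrK.
Qed.

(** Positivity by the criterion of Kelley and Vaught, which makes stability
    under sums immediate. *)
Definition pos x := adj x = x /\ exists2 r, 0 <= r & bnd (cst r - x) r.

Lemma pos_selfadj x : pos x -> adj x = x. Proof. by case. Qed.

Lemma pos_cst r : 0 <= r -> pos (cst r).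
Proof.
move=> r0; split; first exact: adj_cst.
exists r => //; rewrite subrr -(rmorph0 cst).
by apply: bndW (bnd_cst A_comm 0); rewrite normr0.
Qed.

Lemma pos0 : pos 0.
Proof. by rewrite -(rmorph0 cst); exact: pos_cst. Qed.

Lemma pos1 : pos 1.
Proof. by rewrite -(rmorph1 cst); exact: pos_cst. Qed.

Lemma posD x y : pos x -> pos y -> pos (x + y).
Proof.
move=> [sx [r r0 xr]] [sy [s s0 ys]]; split; first by rewrite rmorphD /= sx sy.
exists (r + s); first exact: addr_ge0.
by rewrite rmorphD opprD addrACA; exact: bndD.
Qed.

Lemma posZ r x : 0 <= r -> pos x -> pos (cst r * x).
Proof.
move=> r0 [sx [s s0 xs]]; split; first by rewrite rmorphM /= adj_cst sx.
exists (r * s); first exact: mulr_ge0.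
by rewrite rmorphM -mulrBr; exact: bndMcst.
Qed.

Lemma pos_sum I (r : seq I) (P : pred I) (F : I -> U) :
  (forall i, P i -> pos (F i)) -> pos (\sum_(i <- r | P i) F i).
Proof.
by move=> h; elim/big_ind: _ => //; [exact: pos0 | exact: posD].
Qed.

Lemma bnd_pos x r : adj x = x -> bnd x r -> pos (cst r - x).
Proof.
move=> sx bx; split; first by rewrite rmorphB /= adj_cst sx.
exists r; first exact: bnd_ge0 bx.
by rewrite opprB addrC subrK.
Qed.

(** x + d = (r + d) (1 - y) with y = (r - x) / (r + d) of norm smaller than 1,
    so that [one_sub_sqrt] and [one_sub_inv] apply. *)
Lemma pos_sqrtD x d : pos x -> 0 < d ->
  exists u v, [/\ pos u, adj v = v, u ^+ 2 = x + cst d & v * u = 1].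
Proof.
move=> [sx [r r0 xr]] d0; have rd0 : 0 < r + d by lra.
have [|||z [sz bz zE]] := @one_sub_sqrt (cst (r + d)^-1 * (cst r - x)) ((r + d)^-1 * r).
- by rewrite rmorphM rmorphB /= !adj_cst sx.
- by apply: bndMcst => //; rewrite invr_ge0 ltW.
- by rewrite mulrC ltr_pdivrMr// mul1r; lra.
have r'1 : (r + d)^-1 * r < 1 by rewrite mulrC ltr_pdivrMr// mul1r; lra.
have [w wE] := one_sub_inv bz r'1.
have sw : adj w = w.
  have wE' : (1 - z) * adj w = 1.
    by rewrite -[in LHS]sz -(rmorph1 adj) -rmorphB -rmorphM wE.
  by rewrite -[LHS]mul1r -wE mulrAC wE' mul1r.
pose k := Num.sqrt (r + d); have k0 : 0 < k by rewrite sqrtr_gt0.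
exists (cst k * (1 - z)), (cst k^-1 * w); split.
- apply: posZ; first exact: ltW.
  rewrite (_ : 1 - z = (cst ((r + d)^-1 * r) - z) + cst (1 - (r + d)^-1 * r)).
    by apply: posD; [exact: bnd_pos | apply: pos_cst; rewrite subr_ge0 ltW].
  by rewrite rmorphB rmorph1; ring.
- by rewrite rmorphM /= adj_cst sw.
- rewrite exprMn zE -rmorphXn /= sqr_sqrtr ?ltW// mulrBr mulr1 mulrA -rmorphM.
  by rewrite mulfV ?lt0r_neq0// rmorph1 mul1r rmorphD /=; ring.
- rewrite mulrACA -rmorphM mulVf ?lt0r_neq0// rmorph1 mul1r mulrC.
  exact: wE.
Qed.

(** If v^2 = 1 - (u / s)^2, then v^2 + (u / s)^2 = 1 forces |v| <= 1 by
    [bnd_sqrD]. *)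
Lemma sq_sub_bnd u r s : adj u = u -> bnd u r -> r < s ->
  bnd (cst (s ^+ 2) - u ^+ 2) (s ^+ 2).
Proof.
move=> su bu rs; have r0 := bnd_ge0 bu; have s0 : 0 < s by lra.
have [|||z [sz bz zE]] := @one_sub_sqrt ((cst s^-1 * u) ^+ 2) ((s^-1 * r) ^+ 2).
- by rewrite rmorphXn rmorphM /= adj_cst su.
- by apply/bndX/bndMcst => //; rewrite invr_ge0 ltW.
- rewrite expr_lt1//; last by rewrite mulr_ge0// ?invr_ge0 ltW.
  by rewrite mulrC ltr_pdivrMr// mul1r.
have su' : adj (cst s^-1 * u) = cst s^-1 * u by rewrite rmorphM /= adj_cst su.
have sz' : adj (1 - z) = 1 - z by rewrite rmorphB rmorph1 /= sz.
have := @bnd_sqrD _ _ _ (1 - z) (cst s^-1 * u) 1 sz' su' ler01.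
rewrite zE subrK expr1n.
have b1 : bnd (1 : U) 1 by have := bnd_cst A_comm 1; rewrite rmorph1 normr1.
move=> /(_ b1) /bndX; rewrite expr1n zE => h.
have := bndMcst (sqr_ge0 s) h; rewrite mulr1.
rewrite mulrBr mulr1 exprMn mulrA -rmorphXn -rmorphM exprVn mulfV.
  by rewrite rmorph1 mul1r.
by rewrite sqrf_eq0 lt0r_neq0.
Qed.

Lemma pos_sq u : adj u = u -> pos (u ^+ 2).
Proof.
move=> su; split; first by rewrite rmorphXn /= su.
have [r r0 bu] := ex_bnd u.
exists ((r + 1) ^+ 2); first exact: sqr_ge0.
by apply: sq_sub_bnd su bu _; lra.
Qed.

Lemma bnd_sq u r : adj u = u -> 0 <= r -> bnd (u ^+ 2) (r ^+ 2) -> bnd u r.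
Proof. by move=> su r0 h; apply: bnd_adjM => //; rewrite su -expr2. Qed.

Lemma bnd_sqrt u k : adj u = u -> 0 <= k -> bnd (u ^+ 2) k -> bnd u (Num.sqrt k).
Proof. by move=> su k0 h; apply: bnd_sq; rewrite ?sqrtr_ge0 ?sqr_sqrtr. Qed.

(** As x + d is a square, [sq_sub_bnd] applies with every constant above a bound
    of x.  The constant in [pos] may therefore be any bound of x, which is why
    the cone is closed. *)
Lemma pos_sub_bnd x s : pos x -> bnd x s -> bnd (cst s - x) s.
Proof.
move=> px bx; have s0 := bnd_ge0 bx; apply: (@bnd_lim _ _ _ 3) => // d d0.
have [u [v [pu _ uE _]]] := pos_sqrtD px d0; have su := pos_selfadj pu.
have bu : bnd u (Num.sqrt (s + d)).
  apply: bnd_sqrt => //; first lra.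
  by rewrite uE; apply: bndD => //; rewrite -{2}(gtr0_norm d0); exact: bnd_cst.
have := @sq_sub_bnd u _ (Num.sqrt (s + 2 * d)) su bu.
rewrite ltr_sqrt ?sqr_sqrtr; [|lra..] => /(_ ltac:(lra)) h.
have -> : cst s - x = cst (s + 2 * d) - u ^+ 2 + cst (- d) by rewrite uE; ring.
have -> : s + 3 * d = s + 2 * d + d by lra.
apply: bndD => //.
by rewrite -{2}(gtr0_norm d0) -normrN; exact: bnd_cst.
Qed.

Lemma pos_closed x : (forall d, 0 < d -> pos (x + cst d)) -> pos x.
Proof.
move=> h; split.
  have [+ _] := h 1 ltr01; rewrite rmorphD /= adj_cst; exact: addIr.
have [s s0 bx] := ex_bnd x; exists s; first exact: ltW.
apply: (@bnd_lim _ _ _ 1) => // d d0; rewrite mul1r.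
have -> : cst s - x = cst (s + d) - (x + cst d) by ring.
apply: pos_sub_bnd; first exact: h.
by apply: bndD => //; rewrite -{2}(gtr0_norm d0); exact: bnd_cst.
Qed.

(** Up to d, x and r - x are squares u^2 and v^2 with sum r, and [bnd_sqrD]
    applies. *)
Lemma pos_le_bnd x r : 0 <= r -> pos x -> pos (cst r - x) -> bnd x r.
Proof.
move=> r0 px pr; apply: (@bnd_lim _ _ _ 3) => // d d0.
have [u [_ [pu _ uE _]]] := pos_sqrtD px d0.
have [v [_ [pv _ vE _]]] := pos_sqrtD pr d0.
have rd : 0 <= r + 2 * d by lra.
have bu : bnd u (Num.sqrt (r + 2 * d)).
  apply: (@bnd_sqrD _ _ _ u v); rewrite ?sqrtr_ge0 ?sqr_sqrtr//; [exact: pos_selfadj..|].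
  rewrite uE vE.
  have -> : x + cst d + (cst r - x + cst d) = cst (r + 2 * d) by ring.
  by rewrite -{2}(ger0_norm rd); exact: bnd_cst.
have := bndX bu; rewrite sqr_sqrtr// uE => h.
have -> : x = x + cst d + cst (- d) by ring.
have -> : r + 3 * d = r + 2 * d + d by lra.
apply: bndD => //.
by rewrite -{2}(gtr0_norm d0) -normrN; exact: bnd_cst.
Qed.

(** (x + d) (y + d) is a square, and tends to x y. *)
Lemma posM x y : pos x -> pos y -> pos (x * y).
Proof.
move=> px py; apply: pos_closed => e e0.
have [t t0 bt] := ex_bnd (x + y).
pose d := Num.min 1 (e / (t + 1)).
have d0 : 0 < d by rewrite lt_min ltr01 divr_gt0// addr_gt0.
have de : d * (t + d) <= e.
  have : d <= e / (t + 1) by rewrite ge_min lexx orbT.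
  have d1 : d <= 1 by rewrite ge_min lexx.
  by rewrite ler_pdivlMr ?addr_gt0//; nra.
have [u [_ [pu _ uE _]]] := pos_sqrtD px d0.
have [v [_ [pv _ vE _]]] := pos_sqrtD py d0.
have -> : x * y + cst e =
    (u * v) ^+ 2 + cst d * (cst t - (x + y)) + cst (e - d * (t + d)).
  by rewrite exprMn uE vE; ring.
apply: posD; last by apply: pos_cst; rewrite subr_ge0.
apply: posD; first by apply: pos_sq; rewrite rmorphM /= !pos_selfadj.
apply: posZ; first exact: ltW.
by apply: bnd_pos => //; rewrite rmorphD /= !pos_selfadj.
Qed.

Lemma pos_inv x d : pos x -> 0 < d -> exists2 q, pos q & q * (x + cst d) = 1.
Proof.
move=> px d0; have [u [v [pu sv uE vu]]] := pos_sqrtD px d0.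
exists (v ^+ 2); first exact: pos_sq.
by rewrite -uE -exprMn vu expr1n.
Qed.

Lemma pos_adjM x : pos (adj x * x).
Proof.
have sh : adj (cst 2^-1 * (x + adj x)) = cst 2^-1 * (x + adj x).
  by rewrite rmorphM rmorphD /= adj_cst adjK; ring.
have sk : adj (cst 2^-1 * (imu A_comm * (adj x - x))) = cst 2^-1 * (imu A_comm * (adj x - x)).
  by rewrite !rmorphM rmorphB /= adj_cst adjK adj_imu; ring.
suff -> : adj x * x =
    (cst 2^-1 * (x + adj x)) ^+ 2 + (cst 2^-1 * (imu A_comm * (adj x - x))) ^+ 2.
  by apply: posD; exact: pos_sq.
rewrite !exprMn (expr2 (imu _)) imu2.
transitivity ((cst 2^-1 * 2) ^+ 2 * (adj x * x)).
  by rewrite cst_half expr1n mul1r.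
ring.
Qed.

Lemma pos_snd x : pos x -> exists2 t, 0 <= t & x.2 = t%:C.
Proof.
move=> [sx [r r0 [xr _]]]; have [t xt] := selfadj_snd sx; exists t => //.
move: xr; rewrite /= xt -rmorphB rnorm_real => h.
by have := ler_norm (r - t); lra.
Qed.

(** For positive u and v one has (u - v)^4 <= (u - v)^2 (u + v)^2, and the
    right-hand side is (u^2 - v^2)^2. *)
Lemma sqrt_dist u v k : pos u -> pos v -> 0 <= k ->
  u ^+ 2 - v ^+ 2 = cst (k ^+ 2) -> bnd (u - v) k.
Proof.
move=> pu pv k0 h; have sw : adj (u - v) = u - v by rewrite rmorphB /= !pos_selfadj.
apply: bnd_sq => //; apply: bnd_sq; rewrite ?sqr_ge0//; first by rewrite rmorphXn /= sw.
apply: pos_le_bnd; first by rewrite !sqr_ge0.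
  by apply: pos_sq; rewrite rmorphXn /= sw.
rewrite rmorphXn /= -h.
have -> : (u ^+ 2 - v ^+ 2) ^+ 2 - ((u - v) ^+ 2) ^+ 2 = 
   cst 4 * ((u - v) ^+ 2 * (u * v)) by rewrite rmorph_nat; ring.
by apply: posZ => //; apply: posM; [exact: pos_sq | exact: posM].
Qed.

Lemma rnorm_pos a d : star a = a -> rnorm a <= d -> pos (cst d + emb a).
Proof.
move=> sa ad; rewrite -[emb a]opprK -embN; apply: bnd_pos.
  by rewrite -emb_star starN sa.
by apply: bndW (bnd_emb _ _); rewrite rnormN.
Qed.

(** The square roots of a + 4^-n have scalar part 2^-n, and their components
    in A form a Cauchy sequence by [sqrt_dist]. *)
Lemma pos_sqrt a : pos (emb a) -> exists2 b, pos (emb b) & a = b ** b.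
Proof.
move=> pa; pose q n : R := 2^-1 ^+ n.
have q0 n : 0 < q n by rewrite exprn_gt0// invr_gt0.
have /choice[b Hb] n : exists b, pos (emb b + cst (q n)) /\
    (emb b + cst (q n)) ^+ 2 = emb a + cst (q n ^+ 2).
  have [|u [_ [pu _ uE _]]] := pos_sqrtD pa (d := q n ^+ 2).
    by rewrite exprn_gt0.
  have [t t0 ut] := pos_snd pu.
  have tq : t = q n.
    apply/eqP; rewrite -(@eqrXn2 _ 2)// ?ltW//.
    by move/(congr1 snd): uE; rewrite /= ut add0r -rmorphM => /complexI; rewrite -expr2 => ->.
  exists u.1; have <- : u = emb u.1 + cst (q n).
    by rewrite [LHS]surjective_pairing ut tq; congr (_, _); rewrite /= ?addr0 ?add0r.
  by [].
have qle n m : (n <= m)%N -> q m <= q n.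
  by move=> nm; rewrite ler_wiXn2l//; lra.
have dist n m : (n <= m)%N -> rnorm (b n - b m) <= 2 * q n.
  move=> nm; apply: (rnorm_le_bnd (A_comm := A_comm)).
  have [pn nE] := Hb n; have [pm mE] := Hb m.
  have qq := qle _ _ nm; have qn := q0 n; have qm := q0 m.
  have k0 : 0 <= q n ^+ 2 - q m ^+ 2 by rewrite subr_ge0 ler_sqr// nnegrE ltW.
  have := @sqrt_dist _ _ (Num.sqrt (q n ^+ 2 - q m ^+ 2)) pn pm (sqrtr_ge0 _).
  rewrite nE mE sqr_sqrtr// => /(_ ltac:(ring)) h.
  have -> : emb (b n - b m) = emb (b n) + cst (q n) - (emb (b m) + cst (q m)) + cst (q m - q n).
    by rewrite raddfB /=; ring.
  have := bndD h (bnd_cst A_comm (q m - q n)); apply: bndW.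
  rewrite ler0_norm; last lra.
  suff : Num.sqrt (q n ^+ 2 - q m ^+ 2) <= q n by lra.
  by rewrite -[leRHS](ger0_norm (ltW qn)) -sqrtr_sqr ler_sqrt ?sqr_ge0// lerBlDr lerDl sqr_ge0.
have half01 : 0 <= (2^-1 : R) < 1 by lra.
have [|c cE] := @cauchy_limit _ A b.
  move=> e e0; have [N HN] := geometric_small half01 (ler0n R 2) e0.
  by exists N => n Nn; rewrite rnormB; apply: le_lt_trans (dist _ _ Nn) HN.
have sb n : star (b n) = b n.
  apply: (@emb_inj _ _ A_comm); have [/pos_selfadj + _] := Hb n.
  by rewrite rmorphD /= adj_cst emb_star; exact: addIr.
have sc : star c = c.
  apply: (@selfadj_adherent (range b)) => [_ [n _ <-] //|e /cE[N HN]].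
  by exists (b N); [exists N | rewrite rnormB HN].
have pc : pos (emb c).
  apply: pos_closed => d d0; have d2 : 0 < d / 2 by lra.
  have [N HN] := cE _ d2; have [M HM] := geometric_small half01 ler01 d2.
  pose n := maxn N M; have cn := HN n (leq_maxl _ _).
  have qd : q n <= d / 2.
    by apply: le_trans (qle _ _ (leq_maxr N M)) _; rewrite -[q M]mul1r ltW.
  have -> : emb c + cst d = emb (b n) + cst (q n) + (cst (d - q n) + emb (c - b n)).
    by rewrite embB; ring.
  apply: posD; first by case: (Hb n).
  by apply: rnorm_pos; [rewrite starD starN sc sb | rewrite rnormB; lra].
exists c => //; apply/subr0_eq/rnorm_eq0/eqP; rewrite eq_le rnorm_ge0 andbT.
have c0 := rnorm_ge0 c.
apply: (@ler_addgt0_small _ (4 * rnorm c + 3)); first lra.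
move=> d /andP[d0 d1]; rewrite add0r; have [N HN] := cE d d0.
have [M HM] := geometric_small half01 ler01 d0.
pose n := maxn N M; have := HN n (leq_maxl _ _) => cn.
have qd : q n <= d.
  by apply: le_trans (qle _ _ (leq_maxr N M)) _; rewrite -[q M]mul1r ltW.
have -> : a - c ** c = (b n - c) ** (b n - c) + c ** (b n - c) +
    (b n - c) ** c + (2 * q n)%:C *: (b n - c + c).
  apply: (@emb_inj _ _ A_comm); have [_ nE] := Hb n.
  rewrite !(embD, embN, embM, embZ).
  have -> : emb a = (emb (b n) + cst (q n)) ^+ 2 - cst (q n ^+ 2) by rewrite nE addrK.
  by ring.
have := rnormD (b n - c) c; have := rnorm_ge0 (b n - c + c).
move: cn (rnorm_ge0 (b n - c)) (rnorm_cmul (b n - c) (b n - c)) (rnorm_cmul c (b n - c))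
  (rnorm_cmul (b n - c) c).
set w := b n - c => cn w0 h1 h2 h3 h5 h4.
have h6 := rnormD (w ** w + c ** w + w ** c) ((2 * q n)%:C *: (w + c)).
have h7 := rnormD (w ** w + c ** w) (w ** c); have h8 := rnormD (w ** w) (c ** w).
apply: le_trans h6 _; rewrite rnormZ rnorm_real ger0_norm; last by have := q0 n; lra.
have := q0 n; nra.
Qed.

(** With v = 1 / (u + d), the square of v x is at most 1, so that v x <= 1;
    multiply by u + d. *)
Lemma pos_abs u x : pos u -> adj x = x -> pos (u ^+ 2 - x ^+ 2) -> pos (u - x).
Proof.
move=> pu sx ux; apply: pos_closed => d d0.
have [v pv vE] := pos_inv pu d0; set w := u + cst d in vE.
have sg : adj (v * x) = v * x by rewrite rmorphM /= sx (pos_selfadj pv).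
have b1 : bnd (v * x) 1.
  apply: bnd_sq => //; rewrite expr1n; apply: pos_le_bnd => //; first exact: pos_sq.
  have -> : cst 1 - (v * x) ^+ 2 =
      v ^+ 2 * (u ^+ 2 - x ^+ 2 + (cst (2 * d) * u + cst (d ^+ 2))).
    by rewrite rmorph1 -[1](expr1n _ 2) -vE /w; ring.
  apply: posM; first by apply: pos_sq; exact: pos_selfadj.
  apply: posD => //; apply: posD; first by apply: posZ => //; lra.
  exact/pos_cst/sqr_ge0.
have -> : u - x + cst d = w * (cst 1 - v * x).
  by rewrite mulrBr mulrA (mulrC w v) vE mul1r rmorph1 mulr1 /w; ring.
apply: posM; last exact: bnd_pos.
by apply: posD => //; exact/pos_cst/ltW.
Qed.

(** Positive and negative parts, b + c being the absolute value of a. *)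
Lemma selfadj_pos_sub a : star a = a -> exists b c, [/\ pos (emb b), pos (emb c),
  a = b - c & (b + c) ** (b + c) = a ** a].
Proof.
move=> sa; have sa' : adj (emb a) = emb a by rewrite -emb_star sa.
have [|m pm mE] := @pos_sqrt (a ** a).
  by rewrite embM -expr2; exact: pos_sq.
have p1 : pos (emb m - emb a).
  by apply: pos_abs => //; rewrite !expr2 -!embM -mE subrr; exact: pos0.
have p2 : pos (emb m + emb a).
  rewrite -[emb a]opprK; apply: pos_abs; rewrite ?rmorphN/= ?sa'//.
  by rewrite sqrrN !expr2 -!embM -mE subrr; exact: pos0.
have h2 : 0 <= (2^-1 : R) by lra.
have half (c : A) : 2^-1%:C *: c + 2^-1%:C *: c = c.
  by rewrite -scalerDl -rmorphD (_ : 2^-1 + 2^-1 = 1) ?scale1r//; lra.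
exists (2^-1%:C *: (m + a)), (2^-1%:C *: (m - a)); split.
- by rewrite embZ embD; exact: posZ.
- by rewrite embZ embB; exact: posZ.
- by rewrite -scalerBr opprB (addrC (m + a)) addrA subrK scalerDr half.
- by rewrite -scalerDr addrACA subrr addr0 scalerDr half.
Qed.

Lemma positive_coneP a : positive_cone a <-> pos (emb a).
Proof.
split=> [[b ->]|/pos_sqrt[b pb ->]]; last first.
  by exists b; congr (_ ** _); apply: (@emb_inj _ _ A_comm); rewrite emb_star pos_selfadj.
by rewrite embM emb_star; exact: pos_adjM.
Qed.

End PositiveCone.

(** * Characters from proper modules *)
Section Characters.
Variables (R : realType) (A : cstarAlgType R).
Hypothesis A_comm : commutative (@cmul R A).
Local Notation U := (unitize A_comm).
Implicit Types (x y z p q : U) (M N : set U).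
Local Notation cst := (cst A_comm).
Local Notation emb := (emb A_comm).
Local Notation adj := (@adj R A A_comm).
Local Notation imu := (imu A_comm).

(** The sets on which a character may be required to be nonnegative. *)
Definition pos_module M :=
  [/\ M `<=` [set x | adj x = x], @pos R A A_comm `<=` M,
      forall x y, M x -> M y -> M (x + y) &
      forall p x, pos p -> M x -> M (p * x)].

Definition proper_module M := pos_module M /\ ~ M (-1).

(** The set [M] is added to each member of the chain to cover the empty
    chain. *)
Lemma proper_module_bigcup M (F : set (set U)) : proper_module M ->
  (forall N, F N -> proper_module (M `|` N)) -> total_on F subset ->
  proper_module (M `|` \bigcup_(N in F) N).
Proof.
move=> pM pF tF; have [[saM M_pos addM mulM] M1] := pM.
set T := M `|` _.
have T1 x : T x -> M x \/ exists2 N, F N & (M `|` N) x.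
  by case=> [Mx|[N FN Nx]]; [left | right; exists N => //; right].
have T2 x y : T x -> T y -> (M x /\ M y) \/
    exists2 N, F N & (M `|` N) x /\ (M `|` N) y.
  case=> [Mx|[N FN Nx]] [My|[N' FN' Ny]].
  - by left.
  - by right; exists N' => //; split; [left | right].
  - by right; exists N => //; split; [right | left].
  - right; have [NN'|N'N] := tF _ _ FN FN'.
      by exists N' => //; split; right => //; exact: NN'.
    by exists N => //; split; right => //; exact: N'N.
have NT N : F N -> M `|` N `<=` T.
  by move=> FN x [Mx|Nx]; [left | right; exists N].
split; first split.
- move=> x /T1[/saM//|[N /pF[[saN _ _ _] _]]]; exact: saN.
- by move=> x px; left; exact: M_pos.
- move=> x y Tx Ty; case: (T2 _ _ Tx Ty) => [[Mx My]|[N FN [Nx Ny]]].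
    by left; exact: addM.
  by apply: (NT _ FN); have [[_ _ h _] _] := pF _ FN; exact: h.
- move=> p x pp /T1[Mx|[N FN Nx]]; first by left; exact: mulM.
  by apply: (NT _ FN); have [[_ _ _ h] _] := pF _ FN; exact: h.
- by move=> /T1[//|[N /pF[_ h]]].
Qed.

Lemma maximal_module M : proper_module M -> exists N,
  [/\ proper_module N, M `<=` N & forall N', proper_module N' -> N `<=` N' -> N' `<=` N].
Proof.
move=> pM; have [|N [pN maxN]] := @Zorn_bigcup U [set N | proper_module (M `|` N)].
  by move=> F FP tF; exact: proper_module_bigcup.
exists (M `|` N); split; [exact: pN | by move=> x Mx; left |].
move=> N' pN' sN'; apply: contrapT => nsub; apply: (maxN N').
  split; first by move=> x Nx; apply: sN'; right.
  by move=> h; apply: nsub => x /h; right.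
rewrite /= (_ : M `|` N' = N')//; apply/seteqP.
by split=> [x [Mx|//]|x N'x]; [apply: sN'; left | right].
Qed.

Section Maximal.
Variable M : set U.
Hypotheses (saM : M `<=` [set x | adj x = x]) (M_pos : @pos R A A_comm `<=` M)
  (addM : forall x y, M x -> M y -> M (x + y))
  (mulM : forall p x, pos p -> M x -> M (p * x)) (M1 : ~ M (-1))
  (maxM : forall N', proper_module N' -> M `<=` N' -> N' `<=` M).

Lemma module_cst_ge0 t : M (cst t) -> 0 <= t.
Proof.
move=> Mt; rewrite leNgt; apply/negP => t0; apply: M1.
have -> : -1 = cst (- t)^-1 * cst t.
  by rewrite -rmorphM invrN mulNr mulVf ?ltr0_neq0// rmorphN rmorph1.
by apply: mulM => //; apply: pos_cst; rewrite invr_ge0 oppr_ge0 ltW.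
Qed.

Lemma module_scale t x : 0 < t -> M (cst t * x) -> M x.
Proof.
move=> t0 Mx; have -> : x = cst t^-1 * (cst t * x).
  by rewrite mulrA -rmorphM mulVf ?gt_eqF// rmorph1 mul1r.
by apply: mulM => //; apply: pos_cst; rewrite invr_ge0 ltW.
Qed.

(** If x is not in M, then -1 = m + p x by maximality.  Replacing p by p + d
    with d small changes this to -1/2 = m' + (p + d) x, and dividing by p + d
    exhibits -x in M. *)
Lemma module_total x : adj x = x -> M x \/ M (- x).
Proof.
move=> sx; have [|nMx] := pselect (M x); [by left | right].
pose N := [set y | exists m p, [/\ M m, pos p & y = m + p * x]].
have M0 : M 0 by apply: M_pos; exact: pos0.
have MN : M `<=` N.
  move=> m Mm; exists m, 0; rewrite mul0r addr0; split=> //.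
  exact: pos0.
have : N (-1).
  apply: contrapT => N1; apply: nMx; apply: (maxM (N' := N)) => //; last first.
    by exists 0, 1; rewrite add0r mul1r; split=> //; exact: pos1.
  split=> //; split.
  - move=> _ [m [p [Mm pp ->]]] /=; rewrite rmorphD rmorphM /= sx (pos_selfadj pp).
    by rewrite (saM Mm).
  - by move=> p /M_pos /MN.
  - move=> _ _ [m [p [Mm pp ->]]] [n [q [Mn pq ->]]]; exists (m + n), (p + q).
    split; [exact: addM | exact: posD | by rewrite mulrDl addrACA].
  - move=> r _ pr [m [p [Mm pp ->]]]; exists (r * m), (r * p).
    by split; [exact: mulM | exact: posM | rewrite mulrDr mulrA].
move=> [m [p [Mm pp E]]].
(* 1/2 is left of the constant 1 since d x <= d n = 1/2. *)
have [n n0 bx] := ex_bnd x.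
pose d := (2 * n)^-1; have d0 : 0 < d by rewrite invr_gt0 mulr_gt0.
have dn : d * n = 2^-1 by rewrite /d invfM -mulrA mulVf ?gt_eqF// mulr1.
have [q pq qE] := pos_inv pp d0.
have -> : - x = q * (cst 2^-1 + m + cst d * (cst n - x)).
  rewrite -[x in LHS]mul1r -qE -dn.
  have {}E : m = -1 - p * x by rewrite E addrK.
  have : cst d * cst n *+ 2 = 1 by rewrite -rmorphM dn -mulr_natr cst_half.
  rewrite E rmorphM; set D := cst d; set K := cst n => h.
  ring: h.
apply: mulM => //; apply: addM; first by apply: addM => //; apply/M_pos/pos_cst.
apply: mulM; first exact/pos_cst/ltW.
by apply: M_pos; exact: bnd_pos.
Qed.

(** x = t up to arbitrarily small constants in the order of which M is the
    positive cone; see [module_value] for existence. *)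
Definition is_value x t := adj x = x /\
  forall e, 0 < e -> M (x - cst t + cst e) /\ M (cst t + cst e - x).

Lemma module_value x : adj x = x -> exists t, is_value x t.
Proof.
move=> sx; have [n n0 bx] := ex_bnd x.
pose S := [set r | M (x - cst r)].
have ubS : ubound S n.
  move=> r Sr; rewrite -subr_ge0; apply: module_cst_ge0.
  rewrite (_ : cst (n - r) = cst n - x + (x - cst r)); last by ring.
  by apply: addM => //; apply: M_pos; exact: bnd_pos.
have Sn : S (- n).
  rewrite /S /= (_ : x - cst (- n) = cst n - (- x)); last by ring.
  by apply: M_pos; apply: bnd_pos; [rewrite rmorphN /= sx | exact: bndN].
have hS : has_sup S by split; [exists (- n) | exists n].
exists (sup S); split=> // e e0; split.
  have [r Sr lr] := sup_adherent e0 hS.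
  have -> : x - cst (sup S) + cst e = x - cst r + cst (r - (sup S - e)) by ring.
  by apply: addM => //; apply/M_pos/pos_cst; lra.
have [||] := @module_total (x - cst (sup S + e)).
- by rewrite rmorphB /= sx adj_cst.
- by move=> h; have := sup_upper_bound hS h; lra.
- by move=> h; rewrite (_ : _ - x = - (x - cst (sup S + e)))//; ring.
Qed.

Lemma value_le x t s : is_value x t -> is_value x s -> t <= s.
Proof.
move=> [_ ht] [_ hs]; apply: (@ler_addgt0 _ 2) => // d d0.
have [h1 _] := ht d d0; have [_ h2] := hs d d0.
rewrite -subr_ge0; apply: module_cst_ge0.
by have := addM h1 h2; congr M; ring.
Qed.

Lemma value_uniq x t s : is_value x t -> is_value x s -> t = s.
Proof. by move=> h1 h2; apply/le_anti; rewrite !(@value_le x). Qed.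

Lemma value_cst t : is_value (cst t) t.
Proof.
split=> [|e e0]; first exact: adj_cst.
by rewrite subrr add0r addrAC subrr add0r; split; apply/M_pos/pos_cst/ltW.
Qed.

Lemma valueD x y t s : is_value x t -> is_value y s -> is_value (x + y) (t + s).
Proof.
move=> [sx hx] [sy hy]; split=> [|e e0]; first by rewrite rmorphD /= sx sy.
have [|x1 x2] := hx (e / 2); first by rewrite divr_gt0.
have [|y1 y2] := hy (e / 2); first by rewrite divr_gt0.
have eE : cst e = cst (e / 2) + cst (e / 2) by rewrite -rmorphD -splitr.
by split; [have := addM x1 y1 | have := addM x2 y2]; congr M; rewrite eE; ring.
Qed.

(** For |y| <= c, both (e - x)(c + y) + (e + x)(c - y) = 2 (e c - x y) and its
    analogue with -y are in M. *)
Lemma value0M x y : is_value x 0 -> adj y = y -> is_value (x * y) 0.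
Proof.
move=> [sx hx] sy; split=> [|e e0]; first by rewrite rmorphM /= sx sy.
have [c c0 by_] := ex_bnd y.
have [|x1 x2] := hx (e / c); first exact: divr_gt0.
have pm : pos (cst c - y) by exact: bnd_pos.
have pp : pos (cst c + y).
  by rewrite -[y]opprK; apply: bnd_pos; [rewrite rmorphN /= sy | exact: bndN].
have eE : cst e = cst (e / c) * cst c by rewrite -rmorphM divfK// gt_eqF.
split; apply: (@module_scale 2) => //.
  have := addM (mulM pm x2) (mulM pp x1); congr M.
  by rewrite eE rmorph0 rmorph_nat; ring.
have := addM (mulM pp x2) (mulM pm x1); congr M.
by rewrite eE rmorph0 rmorph_nat; ring.
Qed.

Lemma valueM x y t s : is_value x t -> is_value y s -> is_value (x * y) (t * s).
Proof.
move=> vx vy; have x0 := valueD vx (value_cst (- t)); have y0 := valueD vy (value_cst (- s)).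
rewrite subrr in x0; rewrite subrr in y0.
have sy : adj y = y by case: vy.
have := valueD (valueD (value0M x0 sy) (value0M y0 (adj_cst _ t))) (value_cst (t * s)).
by rewrite !add0r; congr is_value; ring.
Qed.

Lemma value_ge0 x t : M x -> is_value x t -> 0 <= t.
Proof.
move=> Mx [_ h]; apply: (@ler_addgt0 _ 1) => // d d0; rewrite mul1r.
apply: module_cst_ge0; have [_ h2] := h d d0.
by have := addM Mx h2; congr M; ring.
Qed.

End Maximal.

Definition repart x := cst 2^-1 * (x + adj x).
Definition impart x := cst 2^-1 * (imu * (adj x - x)).

Lemma adj_repart x : adj (repart x) = repart x.
Proof. by rewrite rmorphM rmorphD /= adj_cst adjK addrC. Qed.

Lemma adj_impart x : adj (impart x) = impart x.
Proof. by rewrite !rmorphM rmorphB /= adj_cst adjK adj_imu; rewrite /impart; ring. Qed.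

Lemma re_im x : x = repart x + imu * impart x.
Proof.
have h := cst_half A_comm; have i2 := imu2 A_comm; rewrite /repart /impart.
transitivity (cst 2^-1 * 2 * x); first by rewrite h mul1r.
by ring: i2.
Qed.

Lemma repart_eq y z : adj y = y -> adj z = z -> repart (y + imu * z) = y.
Proof.
move=> sy sz; rewrite /repart rmorphD rmorphM /= sy sz adj_imu.
transitivity (cst 2^-1 * 2 * y); last by rewrite cst_half mul1r.
by ring.
Qed.

Lemma impart_eq y z : adj y = y -> adj z = z -> impart (y + imu * z) = z.
Proof.
move=> sy sz; rewrite /impart rmorphD rmorphM /= sy sz adj_imu.
have i2 := imu2 A_comm.
transitivity (cst 2^-1 * 2 * z); last by rewrite cst_half mul1r.
by ring: i2.
Qed.

Definition scal (c : R[i]) : U := (0, c).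

Lemma scalE c : scal c = cst (complex.Re c) + imu * cst (complex.Im c).
Proof.
congr (_, _); rewrite /= ?cmul0l ?scaler0 ?addr0//.
by rewrite {1}[c]complexE.
Qed.

Lemma character_exists M : proper_module M ->
  exists chi : {rmorphism U -> R[i]},
  [/\ forall c, chi (scal c) = c,
      forall x, chi (adj x) = (chi x)^*,
      forall x, pos x -> 0 <= chi x &
      forall x, M x -> 0 <= chi x].
Proof.
move=> /maximal_module[N [[[saN posN addN mulN] N1] MN maxN]].
pose V := is_value N.
have /choice[phi Hphi] x : exists t, adj x = x -> V x t.
  have [sx|nsx] := pselect (adj x = x); last by exists 0.
  by have [t vt] := module_value saN posN addN mulN N1 maxN sx; exists t.
have phiE x t : V x t -> phi x = t.
  by move=> v; apply: (value_uniq addN mulN N1 _ v); apply: Hphi; case: v.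
have phiD x y : adj x = x -> adj y = y -> phi (x + y) = phi x + phi y.
  by move=> sx sy; apply/phiE/(valueD addN); exact: Hphi.
have phiM x y : adj x = x -> adj y = y -> phi (x * y) = phi x * phi y.
  by move=> sx sy; apply: phiE; apply: (valueM posN addN mulN); exact: Hphi.
have phi_cst r : phi (cst r) = r by apply: phiE; exact: value_cst.
have phiN x : adj x = x -> phi (- x) = - phi x.
  move=> sx; have s1 : adj (cst (-1)) = cst (-1) by exact: adj_cst.
  by rewrite -mulN1r -(rmorph1 cst) -rmorphN phiM// phi_cst mulN1r.
have phi_ge0 x : N x -> 0 <= phi x.
  move=> Nx; apply: (value_ge0 addN mulN N1 Nx); apply: Hphi; exact: saN.
pose chi x : R[i] := (phi (repart x))%:C + 'i * (phi (impart x))%:C.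
have chiE y z : adj y = y -> adj z = z -> chi (y + imu * z) = (phi y)%:C + 'i * (phi z)%:C.
  by move=> sy sz; rewrite /chi repart_eq ?impart_eq.
have phi0 : phi 0 = 0 by rewrite -(rmorph0 cst) phi_cst.
have chi_sa x : adj x = x -> chi x = (phi x)%:C.
  move=> sx; have := chiE x 0 sx (rmorph0 _).
  by rewrite mulr0 addr0 phi0 mulr0 addr0.
have sD x y : adj x = x -> adj y = y -> adj (x + y) = x + y.
  by move=> sx sy; rewrite rmorphD /= sx sy.
have sM x y : adj x = x -> adj y = y -> adj (x * y) = x * y.
  by move=> sx sy; rewrite rmorphM /= sx sy.
have sN x : adj x = x -> adj (- x) = - x by move=> sx; rewrite rmorphN /= sx.
have chiB : zmod_morphism chi.
  move=> x y; have xr := adj_repart x; have xi := adj_impart x.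
  have yr := adj_repart y; have yi := adj_impart y.
  rewrite {1}(re_im x) {1}(re_im y).
  rewrite (_ : _ - _ = repart x - repart y + imu * (impart x - impart y)); last by ring.
  have nyr := sN _ yr; have nyi := sN _ yi.
  rewrite (chiE _ _ (sD _ _ xr nyr) (sD _ _ xi nyi)) (phiD _ _ xr nyr) (phiD _ _ xi nyi).
  by rewrite (phiN _ yr) (phiN _ yi) /chi !rmorphD !rmorphN /=; ring.
have chiM : monoid_morphism chi.
  split; first by rewrite chi_sa ?rmorph1// -(rmorph1 cst) phi_cst.
  move=> x y; have xr := adj_repart x; have xi := adj_impart x.
  have yr := adj_repart y; have yi := adj_impart y.
  rewrite {1}(re_im x) {1}(re_im y).
  have i2 := imu2 A_comm.
  rewrite (_ : _ * _ = repart x * repart y - impart x * impart y +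
      imu * (repart x * impart y + impart x * repart y)); last by ring: i2.
  have rr := sM _ _ xr yr; have ii := sM _ _ xi yi; have nii := sN _ ii.
  have ri := sM _ _ xr yi; have ir := sM _ _ xi yr.
  rewrite (chiE _ _ (sD _ _ rr nii) (sD _ _ ri ir)) (phiD _ _ rr nii) (phiD _ _ ri ir).
  rewrite (phiN _ ii) (phiM _ _ xr yr) (phiM _ _ xi yi) (phiM _ _ xr yi).
  rewrite (phiM _ _ xi yr) /chi.
  have j2 : 'i * 'i = -1 :> R[i] by rewrite -expr2 sqrCi.
  rewrite !rmorphD !rmorphN !rmorphM /=; ring: j2.
pose chi2 : {rmorphism U -> R[i]} := HB.pack chi
  (GRing.isZmodMorphism.Build _ _ chi chiB) (GRing.isMonoidMorphism.Build _ _ chi chiM).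
exists chi2; split=> [c|x|x px|x Mx].
- rewrite scalE [LHS](chiE _ _ (adj_cst _ _) (adj_cst _ _)) !phi_cst.
  by rewrite [RHS]complexE.
- have xr := adj_repart x; have xi := adj_impart x.
  have -> : adj x = repart x + imu * - impart x.
    by rewrite {1}(re_im x) rmorphD rmorphM /= xr xi adj_imu mulNr mulrN.
  rewrite [LHS](chiE _ _ xr (sN _ xi)) (phiN _ xi) [in RHS]/= /chi.
  have cr (r : R) : (r%:C)^* = r%:C by rewrite conj_Creal// complex_real.
  by rewrite rmorphD rmorphM /= !cr conjCi rmorphN mulNr mulrN.
- by rewrite /= (chi_sa _ (pos_selfadj px)) lecR; apply/phi_ge0/posN.
- by rewrite /= (chi_sa _ (saN _ (MN _ Mx))) lecR; apply/phi_ge0/MN.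
Qed.

End Characters.

(** * Characters are pure states *)
Section FunctionalNorm.
Variables (R : realType) (A : cstarAlgType R) (f : A -> R[i]).

Lemma functional_norm_le (r : R) :
  (forall a, rnorm a <= 1 -> rnorm (f a) <= r) -> (functional_norm f <= r%:E)%E.
Proof.
move=> h; apply: ge_ereal_sup => _ [a /= a1 <-]; rewrite lee_fin; apply: h.
by move: a1; rewrite rnormE lecE => /andP[].
Qed.

Lemma le_functional_norm a : rnorm a <= 1 ->
  ((rnorm (f a))%:E <= functional_norm f)%E.
Proof.
move=> a1; apply: ereal_sup_ubound; exists a => //=.
by rewrite rnormE lecE /= eqxx.
Qed.

End FunctionalNorm.

Section PureStates.
Variables (R : realType) (A : cstarAlgType R).
Hypothesis A_comm : commutative (@cmul R A).
Local Notation U := (unitize A_comm).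
Implicit Types (x y z p q : U).
Local Notation cst := (cst A_comm).
Local Notation emb := (emb A_comm).
Local Notation adj := (@adj R A A_comm).
Local Notation imu := (imu A_comm).
Local Notation scal := (scal A_comm).

Lemma emb_scale (c : R[i]) a : emb (c *: a) = scal c * emb a.
Proof. by rewrite mul_emb; congr emb; rewrite actE /= cmul0l add0r. Qed.

Variable chi : {rmorphism U -> R[i]}.
Hypotheses (chi_scal : forall c, chi (scal c) = c)
  (chi_adj : forall x, chi (adj x) = (chi x)^*)
  (chi_pos : forall x, pos x -> 0 <= chi x).

Lemma chi_cst r : chi (cst r) = r%:C.
Proof. exact: chi_scal. Qed.

(** |x|^2 <= r^2 in the order, and a character is positive. *)
Lemma chi_bnd x r : bnd x r -> rnorm (chi x) <= r.
Proof.
move=> bx; have r0 := bnd_ge0 bx; apply: ler_sqr_nneg => //.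
have /chi_pos : pos (cst (r ^+ 2) - adj x * x).
  apply: bnd_pos; last by rewrite expr2; apply: bndM => //; exact: bnd_adj.
  by rewrite rmorphM /= adjK mulrC.
rewrite rmorphB (rmorphM chi (adj x)) /= chi_cst chi_adj -normCKC rnormE -rmorphXn /=.
by rewrite subr_ge0 lecR.
Qed.

Variable a0 : A.
Hypothesis chi_a0 : chi (emb a0) != 0.

Lemma chi_unit : exists2 b, pos (emb b) & chi (emb b) = 1.
Proof.
pose b := (rnorm (chi (emb a0)) ^- 2)%:C *: (star a0 ** a0).
exists b.
  by rewrite embZ; apply: posZ; rewrite ?invr_ge0 ?sqr_ge0// embM emb_star; exact: pos_adjM.
rewrite embZ embM emb_star !rmorphM /= chi_cst chi_adj -normCKC.
rewrite rnormE -rmorphXn -rmorphM mulVf//.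
rewrite sqrf_eq0; apply: contra_neq chi_a0; exact: rnorm_eq0.
Qed.

(** For positive b with chi(b) = 1, take f = b / (b + d): it lies between 0 and
    1. *)
Lemma chi_near_unit d : 0 < d ->
  exists2 f : A, rnorm f <= 1 & chi (emb f) = ((1 + d)^-1)%:C.
Proof.
move=> d0; have [b pb chib] := chi_unit; have [q pq qE] := pos_inv pb d0.
have fE : emb (act q b) = 1 - cst d * q by rewrite -mul_emb -qE; ring.
exists (act q b).
  apply: (@rnorm_le_bnd _ _ A_comm); apply: pos_le_bnd => //.
    by rewrite -mul_emb; exact: posM.
  rewrite fE rmorph1 opprB addrC subrK; apply: posZ => //; exact: ltW.
have d1 : (1 + d)%:C != 0 :> R[i].
  by rewrite -(rmorph0 (real_complex R)) (inj_eq (@complexI R)) gt_eqF//; lra.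
have := congr1 chi qE; rewrite rmorphM rmorphD. rewrite chib chi_cst rmorph1.
rewrite -[1 in X in _ * X](rmorph1 (real_complex R)) -rmorphD => h.
by rewrite -mul_emb rmorphM chib mulr1 fmorphV -[RHS]mul1r -h mulfK.
Qed.

Definition char_fun (a : A) : R[i]^o := chi (emb a).

Fact char_linear : linear char_fun.
Proof. by move=> c a b; rewrite /char_fun embD emb_scale rmorphD rmorphM /= chi_scal. Qed.

HB.instance Definition _ := GRing.isLinear.Build R[i] A R[i]^o _ char_fun char_linear.

Fact char_ge0 a : positive_cone a -> 0 <= char_fun a :> R[i].
Proof. by move=> /(positive_coneP A_comm); exact: chi_pos. Qed.

Lemma inv1D_ge d : 0 < d -> 1 - d <= (1 + d)^-1 :> R.
Proof. by move=> d0; rewrite -[leRHS]mul1r ler_pdivlMr; [nra | lra]. Qed.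

Fact char_norm : functional_norm char_fun = 1%E.
Proof.
apply/le_anti/andP; split.
  apply: functional_norm_le => a a1; apply: le_trans a1.
  by apply: chi_bnd; exact: bnd_emb.
apply/lee_addgt0Pr => d d0; have [f f1 chif] := chi_near_unit d0.
apply: le_trans (leeD2r _ (le_functional_norm char_fun f1)).
rewrite -EFinD lee_fin /char_fun chif rnorm_real ger0_norm ?invr_ge0; last lra.
by have := inv1D_ge d0; lra.
Qed.

Definition char_state : state A := State char_ge0 char_norm.

(** On positive elements, phi vanishes where the character does.  If a is
    self-adjoint with chi(a) = 0, then chi(|a|)^2 = chi(a^2) = 0, so that the
    positive and negative parts of a are also in the kernel of chi, hence of
    phi.  Thus phi is a multiple of the character, and the norms agree. *)
Lemma dominated_by_character (phi : state A) (k : R) : 0 < k ->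
  (forall a, positive_cone a -> k%:C * phi a <= char_state a :> R[i]) ->
  phi =1 char_state.
Proof.
move=> k0 dom.
have ker_pos a : positive_cone a -> chi (emb a) = 0 -> phi a = 0.
  move=> pa chia; have := dom a pa; rewrite [X in _ <= X]chia => h.
  apply/le_anti; rewrite (state_ge0 phi pa) andbT.
  by rewrite -(pmulr_rle0 _ (x := k%:C)) ?ltcR.
have ker_sa a : star a = a -> chi (emb a) = 0 -> phi a = 0.
  move=> sa chia; have [b [c [pb pc aE bcE]]] := selfadj_pos_sub A_comm sa.
  have : chi (emb b) + chi (emb c) = 0.
    apply/eqP; rewrite -sqrf_eq0 -rmorphD -embD -rmorphXn expr2 -embM bcE.
    by rewrite embM rmorphM chia mulr0.
  move=> /eqP; rewrite paddr_eq0 ?chi_pos// => /andP[/eqP b0 /eqP c0].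
  have {}pb := (positive_coneP A_comm b).2 pb; have {}pc := (positive_coneP A_comm c).2 pc.
  by rewrite aE raddfB /= (ker_pos _ pb b0) (ker_pos _ pc c0) subrr.
have ker a : chi (emb a) = 0 -> phi a = 0.
  move=> chia; have chisa : chi (emb (star a)) = 0 by rewrite emb_star chi_adj chia rmorph0.
  pose h := a + star a; pose g := 'i *: (a - star a).
  have h0 : phi h = 0.
    by apply: ker_sa; rewrite ?embD ?rmorphD /= ?chia ?chisa ?addr0// starD starK addrC.
  have g0 : phi g = 0.
    apply: ker_sa; last by rewrite emb_scale embB rmorphM rmorphB /= chia chisa subrr mulr0.
    by rewrite starZ starD starN starK conjCi scaleNr -scalerN opprB.
  have : a *+ 2 = h + (- 'i) *: g.
    rewrite /g scalerA mulNr -expr2 sqrCi opprK scale1r addrACA subrr addr0.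
    by rewrite mulr2n.
  move=> a2; have := linearP (state_fun phi) (- 'i) g h.
  rewrite [X in state_fun phi X]addrC -a2 h0 g0 scaler0 addr0 raddfMn.
  by move=> /eqP; rewrite mulrn_eq0 => /eqP.
have [b pb chib] := chi_unit.
have phiE a : phi a = chi (emb a) * phi b.
  have := ker (a - chi (emb a) *: b).
  rewrite embB emb_scale rmorphB rmorphM /= chi_scal chib mulr1 subrr => /(_ erefl).
  move=> ka; have := linearP (state_fun phi) (- chi (emb a)) b a.
  rewrite scaleNr (addrC _ a) ka => /esym/eqP; rewrite scaleNr addrC subr_eq0.
  by move=> /eqP.
have phib : 0 <= phi b := state_ge0 phi ((positive_coneP A_comm b).2 pb).
have phib' : phi b = (rnorm (phi b : R[i]))%:C by rewrite -rnormE ger0_norm.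
suff b1 : rnorm (phi b : R[i]) = 1 by move=> a; rewrite phiE phib' b1 mulr1.
apply/le_anti/andP; split.
  apply: (@ler_addgt0 _ 1) => // d d0; have [f f1 chif] := chi_near_unit d0.
  have := le_functional_norm phi f1; rewrite state_norm1 lee_fin.
  rewrite phiE rnormM chif rnorm_real ger0_norm ?invr_ge0; last lra.
  by rewrite mulrC ler_pdivrMr; lra.
rewrite -lee_fin -(state_norm1 phi); apply: functional_norm_le => a a1.
rewrite phiE rnormM ler_piMl ?rnorm_ge0//; apply: le_trans a1.
by apply: chi_bnd; exact: bnd_emb.
Qed.

Lemma char_state_pure : pure_state char_state.
Proof.
move=> phi psi t /andP[t0 t1] E.
have t1' : 0 < 1 - t by lra.
split; [apply: (dominated_by_character t0) | apply: (dominated_by_character t1')] => a pa.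
  by rewrite E lerDl mulr_ge0 ?(state_ge0 psi pa)// lecR ltW.
by rewrite E lerDr mulr_ge0 ?(state_ge0 phi pa)// lecR ltW.
Qed.

End PureStates.

(** * Separation of A-convex sets *)
Section ConvexSeparation.
Variables (R : realType) (A : cstarAlgType R).
Hypothesis A_comm : commutative (@cmul R A).
Local Notation U := (unitize A_comm).
Implicit Types (x y z p q : U) (a b c : A).
Local Notation cst := (cst A_comm).
Local Notation emb := (emb A_comm).
Local Notation adj := (@adj R A A_comm).
Local Notation pos := (@pos R A A_comm).

Lemma unit_of_Aplus_emb (I : U) : is_unit_of_Aplus I -> forall a, I * emb a = emb a.
Proof. by move=> [_ h] a; case: (h (emb a)) => // _; exists a. Qed.

Lemma unit_of_Aplus_adj (I : U) : is_unit_of_Aplus I -> adj I = I /\ I * I = I.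
Proof.
move=> [AI h]; have AI' : Aplus (adj I).
  by move=> /AI[a _ aI]; exists (star a) => //; rewrite -[LHS]/(emb _) emb_star -aI.
have [h1 _] : I * adj I = adj I /\ adj I * I = adj I := h _ AI'.
have [h2 _] : I * I = I /\ I * I = I := h _ AI.
have h3 := congr1 adj h1; rewrite rmorphM /= adjK in h3.
by split=> //; rewrite -h1 mulrC h3.
Qed.

(** The second clause makes multiplication by the unit a map from U to the
    copy of A^+ in the unital case as well. *)
Lemma exists_unit_of_Aplus : exists I : U,
  is_unit_of_Aplus I /\ forall z, Aplus (z * I).
Proof.
have [[e eE]|nu] := pselect (unital A).
  have eU z : z * emb e = emb (act z e) := mul_emb z e.
  exists (emb e); split; last by move=> z _; exists (act z e) => //; rewrite eU.
  split; first by move=> _; exists e.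
  move=> z Az; have [|a _ <-] := Az; first by exists e.
  rewrite -[umul _ _]/(emb e * emb a) -[umul (uinj a) _]/(emb a * emb e) -!embM.
  by have [-> ->] := eE a.
exists 1; split; last by move=> z.
split=> // z _; split; [exact: (mul1r (z : U)) | exact: (mulr1 (z : U))].
Qed.

Section ConvexModule.
Variables (X : set A) (a0 : A) (eps : R).
Hypotheses (X_pos : forall a, X a -> pos (emb a)) (X_conv : A_convex X)
  (Xa0 : X a0) (eps0 : 0 < eps) (X_eps : forall a, X a -> eps < rnorm a).

Definition weights (s : seq (A * A)) :=
  forall t, t \in s -> pos (emb t.1) /\ X t.2.

Definition shift a : U := emb a - cst eps.

(** The coefficients [emb t.1] are taken in A, and a coefficient in U is allowed
    for the one point [a0] only: partitions of unity have all members but the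
    last in A. *)
Definition convex_module : set U := [set x | exists p p0 s,
  [/\ pos p, pos p0, weights s &
      x = p + p0 * shift a0 + \sum_(t <- s) emb t.1 * shift t.2]].

Lemma adj_shift a : X a -> adj (shift a) = shift a.
Proof. by move=> Xa; rewrite rmorphB /= adj_cst (pos_selfadj (X_pos Xa)). Qed.

Lemma convex_module_pos_module : pos_module convex_module.
Proof.
split.
- move=> _ [p [p0 [s [pp pp0 ws ->]]]] /=.
  rewrite !rmorphD rmorphM rmorph_sum /= adj_shift// !pos_selfadj//; congr (_ + _).
  rewrite big_seq [RHS]big_seq; apply: eq_bigr => t /ws[pt Xt].
  by rewrite rmorphM /= adj_shift// pos_selfadj.
- move=> p pp; exists p, 0, [::].
  by rewrite big_nil mul0r !addr0; split=> //; exact: pos0.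
- move=> _ _ [p [p0 [s [pp pp0 ws ->]]]] [q [q0 [r [pq pq0 wr ->]]]].
  exists (p + q), (p0 + q0), (s ++ r); rewrite big_cat /=; split; [exact: posD..| |ring].
  by move=> t; rewrite mem_cat => /orP[/ws|/wr].
- move=> q _ pq [p [p0 [s [pp pp0 ws ->]]]].
  exists (q * p), (q * p0), [seq (act q t.1, t.2) | t <- s].
  split; [exact: posM..| |].
    move=> _ /mapP[t /ws[pt Xt] ->]; split=> //=.
    by rewrite -mul_emb; exact: posM.
  rewrite big_map mulrDr (mulrDr q p) (mulrA q p0) mulr_sumr; congr (_ + _).
  apply: eq_bigr => t _.
  by rewrite /= -mul_emb mulrA.
Qed.

(** With S = p0 + sum c_i, an expression of -1 gives
    e S = 1 + p + p0 a0 + sum c_i a_i >= 1, hence S has an invertible root and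
    sum c_i a_i + p0 a0 <= e S.  Division by S turns this into an A-convex
    combination of norm at most e. *)
Lemma convex_module_proper : ~ convex_module (-1).
Proof.
move=> [p [p0 [s [pp pp0 ws E]]]].
have [I [Iunit AI]] := exists_unit_of_Aplus.
have Iemb := unit_of_Aplus_emb Iunit; have [sI II] := unit_of_Aplus_adj Iunit.
have /choice[sq Hsq] a : exists b, pos (emb a) -> pos (emb b) /\ a = b ** b.
  have [pa|npa] := pselect (pos (emb a)); last by exists 0.
  by have [b pb ab] := pos_sqrt pa; exists b.
(* The coefficient of a0 must be a single square, and p0 + d is one; with this d
   one has d a0 <= 1, so that the change is absorbed by the constant 1. *)
pose d := (rnorm a0 + 1)^-1.
have d0 : 0 < d by rewrite invr_gt0 ltr_wpDl ?rnorm_ge0.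
pose C := \sum_(t <- s) emb t.1; pose D := \sum_(t <- s) emb t.1 * emb t.2.
have CD : \sum_(t <- s) emb t.1 * shift t.2 = D - cst eps * C.
  rewrite /D /C mulr_sumr -sumrB; apply: eq_bigr => t _; rewrite /shift; ring.
have pD : pos D.
  rewrite /D big_seq; apply: pos_sum => t /ws[pt Xt]; apply: posM => //.
  exact: X_pos.
pose T := p + p0 * emb a0 + D + cst (eps * d).
have pT : pos T.
  apply: posD; last by apply: pos_cst; rewrite mulr_ge0 ?ltW.
  by apply: posD => //; apply: posD => //; apply: posM => //; exact: X_pos.
have ie : 0 < eps^-1 by rewrite invr_gt0.
have [w [v [pw sv wE vw]]] := pos_sqrtD (posZ (ltW ie) pT) ie.
have ee : cst eps * cst eps^-1 = 1 by rewrite -rmorphM mulfV ?gt_eqF// rmorph1.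
have SE : cst eps * (p0 + cst d + C) = 1 + T.
  move: E; rewrite CD /shift /T rmorphM => E.
  by rewrite -[1]opprK E; ring.
have wS : w ^+ 2 = p0 + cst d + C.
  rewrite wE -[RHS]mul1r -ee (mulrC (cst eps)) -mulrA SE; ring.
have [q0 [_ [pq0 _ q0E _]]] := pos_sqrtD pp0 d0.
pose n := size s; pose t0 : A * A := (0, 0).
pose tt (j : 'I_n.+1) := nth t0 s j.
pose xx (j : 'I_n.+1) := if (j < n)%N then (tt j).2 else a0.
(* The factor I moves the weights from U to A^+ and fixes A. *)
pose rho (j : 'I_n.+1) : U :=
  if (j < n)%N then v * emb (sq (tt j).1) * I else v * q0 * I.
have wt (j : 'I_n.+1) : (j < n)%N -> pos (emb (tt j).1) /\ X (tt j).2.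
  by move=> jn; apply: ws; exact: mem_nth.
have rhoE (j : 'I_n.+1) : adj (rho j) * rho j =
    v ^+ 2 * (if (j < n)%N then emb (tt j).1 else p0 + cst d) * I.
  rewrite /rho; case: ifPn => [/wt[pt _]|_].
    have [ps tE] := Hsq _ pt.
    by rewrite {3}tE embM !rmorphM /= sv sI (pos_selfadj ps) -[in RHS]II; ring.
  by rewrite -q0E !rmorphM /= sv sI (pos_selfadj pq0) -[in RHS]II; ring.
have sumE (F : A * A -> U) (G : U) :
    \sum_(j < n.+1) (if (j < n)%N then F (tt j) else G) = \sum_(t <- s) F t + G.
  rewrite big_ord_recr /= ltnn (big_nth t0) big_mkord; congr (_ + _).
  by apply: eq_bigr => j _; rewrite /= ltn_ord.
have prho : partition_of_unity rho.
  split.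
  - move=> j jn; have jn' : (j < n)%N.
      by rewrite ltn_neqAle -ltnS ltn_ord andbT; apply: contra jn => /eqP jn; apply/eqP/val_inj.
    exists (act (v * I) (sq (tt j).1)) => //.
    by rewrite -[LHS]/(emb _) -mul_emb /rho jn' mulrAC.
  - by rewrite /rho /= ltnn; exact: AI.
  - rewrite [X in is_unit_of_Aplus X](_ : _ = I) //.
    transitivity (\sum_(j < n.+1) adj (rho j) * rho j) => //.
    under eq_bigr do rewrite rhoE.
    rewrite -mulr_suml -mulr_sumr (sumE (fun t => emb t.1)) addrC -/C.
    by rewrite -wS -exprMn vw expr1n mul1r.
have Xx j : X (xx j) by rewrite /xx; case: ifPn => // /wt[].
have [a Xa aE] := X_conv Xx prho.
have {}aE : emb a = v ^+ 2 * (D + (p0 + cst d) * emb a0).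
  rewrite -[emb a]/(uinj a) aE.
  transitivity (\sum_(j < n.+1) adj (rho j) * emb (xx j) * rho j) => //.
  rewrite /D -(sumE (fun t => emb t.1 * emb t.2)) mulr_sumr; apply: eq_bigr => j _.
  rewrite mulrAC rhoE -!mulrA Iemb; congr (_ * _); rewrite /xx.
  by case: ifP.
have := X_eps Xa; apply/negP; rewrite -leNgt.
apply: (@rnorm_le_bnd _ _ A_comm); apply: pos_le_bnd; [exact: ltW | exact: X_pos |].
have -> : cst eps - emb a = v ^+ 2 * (1 + p + cst (eps * d) - cst d * emb a0).
  have e1 : cst eps = v ^+ 2 * (cst eps * (p0 + cst d + C)).
    by rewrite mulrCA -wS -exprMn vw expr1n mulr1.
  rewrite aE {1}e1.
  transitivity (v ^+ 2 *
    (cst eps * (p0 + cst d + C) - (D + (p0 + cst d) * emb a0))); first by ring.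
  by rewrite SE /T; ring.
apply: posM; first exact: pos_sq.
have -> : 1 + p + cst (eps * d) - cst d * emb a0 =
    p + cst (eps * d) + (cst 1 - cst d * emb a0) by rewrite rmorph1; ring.
apply: posD; first by apply: posD => //; apply: pos_cst; rewrite mulr_ge0 ?ltW.
apply: bnd_pos; first by rewrite rmorphM /= adj_cst (pos_selfadj (X_pos Xa0)).
apply: (@bndW _ _ _ _ (d * rnorm a0)).
  by rewrite mulrC /d ler_pdivrMr ?ltr_wpDl ?rnorm_ge0// mul1r lerDl.
by apply: bndMcst; [exact: ltW | exact: bnd_emb].
Qed.

End ConvexModule.

Theorem commutative_convex_separation : convex_separation A.
Proof.
move=> X [a0 Xa0] Xcl Xpos Xconv X0.
have X_pos a : X a -> pos (emb a) by move=> /Xpos /(positive_coneP A_comm).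
have [e e0 Xe] : exists2 e : R, 0 < e & forall a, X a -> e < rnorm a.
  apply: contrapT => h; apply: X0; apply: closed_adherent => // e e0.
  apply: contrapT => h'; apply: h; exists (e / 2); first by rewrite divr_gt0.
  move=> a Xa; rewrite ltNge; apply/negP => ae; apply: h'; exists a => //.
  by rewrite sub0r rnormN; lra.
have pM : proper_module (convex_module X a0 e).
  split; first exact: convex_module_pos_module.
  exact: convex_module_proper.
have [chi [chi_scal chi_adj chi_pos chiM]] := character_exists pM.
have chi_shift a : chi (shift e a) = chi (emb a) - e%:C.
  by rewrite rmorphB; congr (_ - _); exact: chi_scal.
have chi_a0 : e%:C <= chi (emb a0).
  rewrite -subr_ge0 -chi_shift; apply: chiM; exists 0, 1, [::].
  by rewrite big_nil mul1r add0r addr0; split=> //; [exact: pos0 | exact: pos1].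
have e0' : 0 < e%:C :> R[i] by rewrite ltcR.
have a0_gt0 := lt_le_trans e0' chi_a0.
have a0_neq0 : chi (emb a0) != 0 by rewrite gt_eqF.
exists e => //; exists (char_state chi_scal chi_adj chi_pos a0_neq0).
  exact: char_state_pure.
(* chi (a0 (a - e)) >= 0, where a0 serves as a coefficient from A. *)
move=> a Xa; rewrite -[X in _ <= X]/(chi (emb a)) -subr_ge0 -chi_shift.
rewrite -(pmulr_rge0 _ a0_gt0) -rmorphM; apply: chiM; exists 0, 0, [:: (a0, a)].
rewrite big_seq1 mul0r !add0r; split=> //; [exact: pos0 | exact: pos0 |].
by move=> t; rewrite inE => /eqP -> /=; split=> //; exact: X_pos.
Qed.

End ConvexSeparation.

(** * Projection in Hilbert spaces *)
Section HilbertProjection.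
Variables (R : realType) (H : hilbertType R).
Implicit Types (u v x y p : H) (S : set H).

Fact hdot_ge0 x : 0 <= hdot x x.
Proof. by rewrite -hdot_norm exprn_ge0. Qed.

Definition hsip : semi_inner H := SemiInner (@hdot_linear R H) (@hdot_conj R H) hdot_ge0.

Lemma hdot_rnorm x : hsip x x = (rnorm x ^+ 2)%:C.
Proof. by rewrite rmorphXn /= -rnormE hdot_norm. Qed.

Lemma parallelogram x y :
  rnorm (x + y) ^+ 2 + rnorm (x - y) ^+ 2 = 2 * (rnorm x ^+ 2 + rnorm y ^+ 2).
Proof.
apply: complexI; rewrite [RHS]rmorphM [X in _ = _ * X]rmorphD [LHS]rmorphD /=.
rewrite -!hdot_rnorm (rmorph_nat (real_complex R)).
by rewrite !sipDl !sipDr !sipNl !sipNr; ring.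
Qed.

(** Take c = t <u, v> with t small: the first-order term of |v - c u|^2 is
    -2 t |<u, v>|^2. *)
Lemma orthogonal_of_minimal u v :
  (forall c : R[i], rnorm v <= rnorm (v - c *: u)) -> hdot u v = 0.
Proof.
move=> minv; set k := hdot u v; pose t := (rnorm u ^+ 2 + 1)^-1.
have u2 : 0 <= rnorm u ^+ 2 by exact: sqr_ge0.
have t0 : 0 < t by rewrite invr_gt0; lra.
have tu : t * (rnorm u ^+ 2 + 1) = 1 by rewrite mulVf//; lra.
have E : rnorm (v - (t%:C * k) *: u) ^+ 2 =
    rnorm v ^+ 2 + rnorm k ^+ 2 * (t ^+ 2 * rnorm u ^+ 2 - 2 * t).
  have kk : (rnorm k ^+ 2)%:C = k^* * k by rewrite -normCKC rnormE rmorphXn.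
  have tt : (t%:C)^* = t%:C :> R[i] by rewrite conj_Creal// complex_real.
  apply: complexI; transitivity ((rnorm v ^+ 2)%:C + (rnorm k ^+ 2)%:C *
      (t%:C ^+ 2 * (rnorm u ^+ 2)%:C - 2 * t%:C)); last first.
    by rewrite -(rmorph_nat (real_complex R)) -!rmorphXn -!rmorphM -rmorphB -rmorphM -rmorphD.
  rewrite kk -!hdot_rnorm sipDl !sipDr !sipNl !sipNr !sipZl !sipZr.
  by rewrite -[hsip v u](sip_conj hsip u v) -[hsip u v]/k rmorphM /= tt; ring.
have := minv (t%:C * k); rewrite -(@ler_pXn2r _ 2)// ?nnegrE ?rnorm_ge0// E.
rewrite -subr_ge0 addrC addrA addNr add0r => h.
apply: rnorm_eq0; apply/eqP; rewrite -sqrf_eq0 eq_le sqr_ge0 andbT.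
have := sqr_ge0 (rnorm k); nra.
Qed.

(** A minimizing sequence for the distance from p to S is Cauchy by the
    parallelogram identity; its limit l may lie outside S, and v = p - l. *)
Lemma projection_exists S p (d : R) :
  (forall (c : R[i]) x y, S x -> S y -> S (c *: x + y)) -> S 0 -> 0 < d ->
  (forall s, S s -> d <= rnorm (p - s)) ->
  exists v, v <> 0 /\ forall u, S u -> hdot u v = 0.
Proof.
move=> Slin S0 d0 Sd; pose Q := [set rnorm (p - s) | s in S].
have hQ : has_inf Q.
  by split; [exists (rnorm (p - 0)), 0 | exists d => _ [s Ss <-]; exact: Sd].
pose D := inf Q.
have DQ s : S s -> D <= rnorm (p - s).
  by move=> Ss; apply: inf_lbound => //; [exact: hQ.2 | exists s].
have dD : d <= D by apply: lb_le_inf; [exact: hQ.1 | move=> _ [s Ss <-]; exact: Sd].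
have half01 : 0 <= (2^-1 : R) < 1 by lra.
pose q n : R := 2^-1 ^+ n.
have q0 n : 0 < q n by rewrite exprn_gt0// invr_gt0.
have qle n m : (n <= m)%N -> q m <= q n by move=> nm; rewrite ler_wiXn2l//; lra.
have /choice[s Hs] n : exists s, S s /\ rnorm (p - s) < D + q n.
  by have [_ [s Ss <-] ?] := inf_adherent (q0 n) hQ; exists s.
have dist n m : (n <= m)%N -> rnorm (s m - s n) ^+ 2 <= 4 * (2 * D + 1) * q n.
  move=> nm; have [Sn sn] := Hs n; have [Sm sm] := Hs m.
  have := parallelogram (p - s n) (p - s m).
  have -> : p - s n - (p - s m) = s m - s n by rewrite opprB addrC addrA subrK.
  have -> : p - s n + (p - s m) = 2 *: (p - 2^-1 *: (s n + s m)).
    rewrite scalerBr scalerA mulfV ?pnatr_eq0// scale1r scaler_nat mulr2n.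
    by rewrite addrACA opprD.
  rewrite rnormZ [rnorm (2 : R[i])](_ : _ = 2); last first.
    by rewrite -(rmorph_nat (real_complex R)) rnorm_real ger0_norm.
  have /DQ : S (2^-1 *: (s n + s m)).
    rewrite -[_ *: _]addr0; apply: (Slin) => //; rewrite -[s n]scale1r; exact: Slin.
  have := qle _ _ nm; have := q0 n; have := rnorm_ge0 (p - s m); have := rnorm_ge0 (p - s n).
  have : q n <= 1 by have := qle 0%N n (leq0n _); rewrite /q expr0.
  move: sn sm; set a := rnorm (p - s n); set b := rnorm (p - s m).
  set c := rnorm (p - _); set e := rnorm (s m - s n) => h1 h2 h3 h4 h5 h6 h7 h8 h9.
  have : a ^+ 2 <= (D + q n) ^+ 2 by nra.
  have : b ^+ 2 <= (D + q n) ^+ 2 by nra.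
  have : D ^+ 2 <= c ^+ 2 by nra.
  nra.
have [|l sl] := @cauchy_limit _ H s.
  move=> e e0; have CD : 0 <= 4 * (2 * D + 1) by lra.
  have e2 : 0 < e ^+ 2 by rewrite exprn_gt0.
  have [N HN] := geometric_small half01 CD e2; exists N => n Nn.
  rewrite -(@ltr_pXn2r _ 2)// ?nnegrE ?rnorm_ge0 ?ltW//.
  exact: le_lt_trans (dist _ _ Nn) HN.
exists (p - l); split.
  move=> pl; suff : d <= 0 by rewrite leNgt d0.
  apply: (@ler_addgt0 _ 1) => // e e0; have [N HN] := sl e e0.
  have [SN _] := Hs N; apply: le_trans (Sd _ SN) _.
  have := rnormD (p - l) (l - s N); rewrite addrA subrK pl rnorm0 (rnormB l).
  by have := HN N (leqnn _); lra.
move=> u Su; apply: orthogonal_of_minimal => c.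
apply: (@ler_addgt0 _ 3) => // e e0; have [N HN] := sl e e0.
have [M HM] := geometric_small half01 ler01 e0.
pose n := maxn N M; have := HN n (leq_maxl _ _) => nl.
have qe : q n < e.
  by apply: le_lt_trans (qle _ _ (leq_maxr N M)) _; rewrite -[q M]mul1r.
have [Sn sn] := Hs n.
have := DQ _ (Slin c u (s n) Su Sn).
have := rnormD (p - s n) (s n - l); rewrite addrA subrK.
have := rnormD (p - l - c *: u) (l - s n).
have -> : p - l - c *: u + (l - s n) = p - (c *: u + s n).
  by rewrite opprD !addrA; congr (_ - _); rewrite addrAC subrK.
rewrite (rnormB l); lra.
Qed.

End HilbertProjection.

(** * Separation of submodules *)
Section ModuleSeparation.
Variables (R : realType) (A : cstarAlgType R).
Hypothesis A_comm : commutative (@cmul R A).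
Local Notation U := (unitize A_comm).
Local Notation cst := (cst A_comm).
Local Notation emb := (emb A_comm).
Local Notation adj := (@adj R A A_comm).
Local Notation scal := (scal A_comm).
Local Notation pos := (@pos R A A_comm).
Variable E : hilbertModType A.
Implicit Types (x y : E) (z : U) (a b : A).

(** The inner product with values in U, where identities are ring identities. *)
Definition uip x y : U := emb (ip x y).

Lemma uip_linear x y y' (c : R[i]) : uip x (c *: y + y') = scal c * uip x y + uip x y'.
Proof. by rewrite /uip ip_linear embD emb_scale. Qed.

Lemma uipDr x y y' : uip x (y + y') = uip x y + uip x y'.
Proof.
by have := uip_linear x y y' 1; rewrite scale1r -[scal 1]/(1 : U) mul1r.
Qed.

Lemma uip0r x : uip x 0 = 0.
Proof. by apply: (addrI (uip x 0)); rewrite -uipDr !addr0. Qed.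

Lemma uipNr x y : uip x (- y) = - uip x y.
Proof. by apply: (addrI (uip x y)); rewrite -uipDr !subrr uip0r. Qed.

Lemma adj_uip x y : adj (uip x y) = uip y x.
Proof. by rewrite -emb_star ip_star. Qed.

Lemma uipDl x x' y : uip (x + x') y = uip x y + uip x' y.
Proof. by rewrite -adj_uip uipDr rmorphD /= !adj_uip. Qed.

Lemma uipNl x y : uip (- x) y = - uip x y.
Proof. by rewrite -adj_uip uipNr rmorphN /= adj_uip. Qed.

Definition uract x z : E := ract x z.1 + z.2 *: x.

Lemma uip_uractr x y z : uip x (uract y z) = uip x y * z.
Proof.
rewrite /uract addrC uip_linear /uip ip_ract embM [RHS]mulrC.
rewrite (mulrC (emb _)) -mulrDl; congr (_ * _).
by rewrite [RHS]surjective_pairing; congr (_, _); rewrite /= ?add0r ?addr0.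
Qed.

Lemma uip_sumr x n (F : 'I_n -> E) : uip x (\sum_j F j) = \sum_j uip x (F j).
Proof. by apply: (big_morph (uip x)); [exact: uipDr | exact: uip0r]. Qed.

Lemma pos_uip x : pos (uip x x).
Proof. by apply/positive_coneP; exact: ip_ge0. Qed.

Lemma rnorm_ip x : rnorm (ip x x) = rnorm x ^+ 2.
Proof. by apply: complexI; rewrite rmorphXn /= -!rnormE ip_norm. Qed.

Lemma uip_eq0 x : uip x x = 0 -> x = 0.
Proof.
move=> h; apply: rnorm_eq0; apply/eqP; rewrite -sqrf_eq0 -rnorm_ip.
by rewrite (_ : ip x x = 0) ?rnorm0//; apply: (@emb_inj _ _ A_comm).
Qed.

(** The unit of A^+ fixes every <z, x>, so that x I - x is orthogonal to every
    vector, itself included. *)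
Lemma uract_unit (I : U) x : is_unit_of_Aplus I -> uract x I = x.
Proof.
move=> hI; apply/subr0_eq/uip_eq0.
rewrite uipDr uipNr uip_uractr mulrC unit_of_Aplus_emb//; exact: subrr.
Qed.

Lemma uractDl x y z : uract (x + y) z = uract x z + uract y z.
Proof. by rewrite /uract ractDl scalerDr addrACA. Qed.

Lemma uractDr x z z' : uract x (z + z') = uract x z + uract x z'.
Proof. by rewrite /uract /= ractDr scalerDl addrACA. Qed.

Lemma uract0l z : uract 0 z = 0.
Proof. by apply: (addrI (uract 0 z)); rewrite -uractDl !addr0. Qed.

Lemma uract0r x : uract x 0 = 0.
Proof. by apply: (addrI (uract x 0)); rewrite -uractDr !addr0. Qed.

Lemma uractNl x z : uract (- x) z = - uract x z.
Proof. by apply: (addrI (uract x z)); rewrite -uractDl !subrr uract0l. Qed.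

Lemma uract_sumr x n (F : 'I_n -> U) : uract x (\sum_j F j) = \sum_j uract x (F j).
Proof. by apply: (big_morph (uract x)); [exact: uractDr | exact: uract0r]. Qed.

Lemma pos_one_sub_unit (I : U) : is_unit_of_Aplus I -> pos (1 - I).
Proof.
move=> /unit_of_Aplus_adj[sI II].
rewrite (_ : 1 - I = (1 - I) ^+ 2); last by rewrite expr2; ring: II.
by apply: pos_sq; rewrite rmorphB rmorph1 /= sI.
Qed.

Section Submodule.
Variables (L : set E) (x0 : E).
Hypotheses (Lsub : is_submodule L).

(** The upward closure, in the sense of the order, of the set of all
    <x0 - l, x0 - l>: an A-convex combination of such elements only dominates
    an element of this form.  The constant [d] makes the set norm closed. *)
Definition above_distances : set A := [set a | pos (emb a) /\
  forall d : R, 0 < d -> exists2 l, L l & pos (emb a + cst d - uip (x0 - l) (x0 - l))].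

Lemma above_distances_ip l : L l -> above_distances (ip (x0 - l) (x0 - l)).
Proof.
move=> Ll; split; first exact: pos_uip.
by move=> d d0; exists l => //; rewrite addrAC subrr add0r; exact/pos_cst/ltW.
Qed.

Lemma above_distances_closed : closed above_distances.
Proof.
apply: adherent_closed => a ad.
have star_pos b : pos (emb b) -> star b = b.
  by move=> pb; apply: (@emb_inj _ _ A_comm); rewrite emb_star pos_selfadj.
have sa : star a = a.
  by apply: (selfadj_adherent _ ad) => b [pb _]; exact: star_pos.
have near d : 0 < d -> exists2 b, above_distances b & pos (cst d + emb (a - b)).
  move=> d0; have [b Xb ab] := ad d d0; exists b => //; apply: rnorm_pos; last exact: ltW.
  by rewrite starD starN sa star_pos//; case: Xb.
split.
  apply: pos_closed => d d0; have [b [pb _] pab] := near d d0.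
  by have := posD pb pab; rewrite embB; congr pos; ring.
move=> d d0; have d2 : 0 < d / 2 by rewrite divr_gt0.
have [b [_ Xb] pab] := near _ d2; have [l Ll pl] := Xb _ d2; exists l => //.
have dE : cst d = cst (d / 2) + cst (d / 2) by rewrite -rmorphD -splitr.
by have := posD pl pab; rewrite embB dE; congr pos; ring.
Qed.

Lemma submodule_uract l z : L l -> L (uract l z).
Proof.
by case: Lsub => _ Llin Lact Ll; rewrite /uract addrC; apply: Llin => //; exact: Lact.
Qed.

Lemma submodule_sum n (F : 'I_n -> E) : (forall j, L (F j)) -> L (\sum_j F j).
Proof.
case: Lsub => L0 Llin _ LF; apply: big_ind => // x y Lx Ly.
by rewrite -[x]scale1r; exact: Llin.
Qed.

(** Expand the inner products: the cross terms sum up to <x, x>. *)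
Lemma weighted_variance n (w : 'I_n -> U) (y : 'I_n -> E) (x : E) :
  (forall j, adj (w j) = w j) -> is_unit_of_Aplus (\sum_j w j) ->
  x = \sum_j uract (y j) (w j) ->
  \sum_j w j * uip (y j - x) (y j - x) = \sum_j w j * uip (y j) (y j) - uip x x.
Proof.
move=> sw Iw xE.
have E1 : \sum_j w j * uip x (y j) = uip x x.
  rewrite {3}xE uip_sumr; apply: eq_bigr => j _.
  by rewrite uip_uractr mulrC.
have E2 : \sum_j w j * uip (y j) x = uip x x.
  rewrite -[RHS]adj_uip -E1 rmorph_sum; apply: eq_bigr => j _.
  by rewrite rmorphM /= sw adj_uip.
have E3 : \sum_j w j * uip x x = uip x x by rewrite -mulr_suml unit_of_Aplus_emb.
rewrite -[X in _ - X]E3 -sumrB.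
transitivity (\sum_j (w j * uip (y j) (y j) - w j * uip x x) +
  (\sum_j w j * uip x x - \sum_j w j * uip x (y j)) +
  (\sum_j w j * uip x x - \sum_j w j * uip (y j) x)).
  rewrite -!sumrB -!big_split; apply: eq_bigr => j _ /=.
  by rewrite uipDl !uipDr uipNl !uipNr uipNl; ring.
by rewrite E1 E2 E3 subrr !addr0.
Qed.

(** The approximating vector of L is the mean of the l_j with the weights
    w_j = rho_j^* rho_j. *)
Lemma above_distances_convex : A_convex above_distances.
Proof.
move=> n x rho Xx [_ _ Iunit].
pose w j : U := adj (rho j : U) * (rho j : U).
have {}Iunit : is_unit_of_Aplus (\sum_j w j) by exact: Iunit.
have pw j : pos (w j) by exact: pos_adjM.
have embE : emb (\sum_j act (w j) (x j)) = \sum_j w j * emb (x j).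
  by rewrite (raddf_sum emb) /=; apply: eq_bigr => j _; rewrite -mul_emb.
exists (\sum_j act (w j) (x j)); last first.
  transitivity (\sum_j adj (rho j : U) * emb (x j) * (rho j : U)) => //.
  by rewrite -[LHS]/(emb _) embE; apply: eq_bigr => j _; rewrite /w mulrAC.
split.
  by rewrite embE; apply: pos_sum => j _; apply: posM => //; case: (Xx j).
move=> d d0; have /choice[l Hl] j : exists l, L l /\
    pos (emb (x j) + cst d - uip (x0 - l) (x0 - l)).
  by have [_ /(_ d d0)[l Ll pl]] := Xx j; exists l.
exists (\sum_j uract (l j) (w j)).
  by apply: submodule_sum => j; apply: submodule_uract; case: (Hl j).
set y := x0 - _.
have yE : y = \sum_j uract (x0 - l j) (w j).
  rewrite /y -{1}(uract_unit x0 Iunit) uract_sumr -sumrB.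
  by apply: eq_bigr => j _; rewrite uractDl uractNl.
have V := weighted_variance (fun j => pos_selfadj (pw j)) Iunit yE.
have -> : emb (\sum_j act (w j) (x j)) + cst d - uip y y =
    \sum_j w j * (emb (x j) + cst d - uip (x0 - l j) (x0 - l j)) +
    \sum_j w j * uip (x0 - l j - y) (x0 - l j - y) +
    cst d * (1 - \sum_j w j).
  rewrite V embE.
  have -> : \sum_j w j * (emb (x j) + cst d - uip (x0 - l j) (x0 - l j)) =
      \sum_j w j * emb (x j) + (\sum_j w j) * cst d -
      \sum_j w j * uip (x0 - l j) (x0 - l j).
    rewrite mulr_suml -big_split -sumrB; apply: eq_bigr => j _ /=; ring.
  ring.
apply: posD; last by apply: posZ; [exact: ltW | exact: pos_one_sub_unit].
apply: posD; apply: pos_sum => j _; apply: posM => //; first by case: (Hl j).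
exact: pos_uip.
Qed.

Lemma above_distances_neq0 : closed L -> ~ L x0 -> ~ above_distances 0.
Proof.
move=> Lcl nL [_ h]; apply: nL; apply: closed_adherent => // e e0.
(* The factor 1/2 yields the strict inequality. *)
pose d := (e / 2) ^+ 2; have d0 : 0 < d by rewrite exprn_gt0// divr_gt0.
have [l Ll pl] := h d d0; exists l => //.
rewrite -[emb 0]/(0 : U) add0r in pl.
have := rnorm_le_bnd (pos_le_bnd (ltW d0) (pos_uip _) pl).
rewrite rnorm_ip => /ler_sqr_nneg -/(_ ltac:(lra)).
lra.
Qed.

(** The square of the distance from iota(x0) to iota(l) is the value of the
    state at <x0 - l, x0 - l>, an element of [above_distances]. *)
Lemma separating_state : convex_separation A -> closed L -> ~ L x0 ->
  exists2 w : state A, pure_state w & exists2 d : R, 0 < d &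
    forall l, L l -> d <= rnorm (iota_loc w x0 - iota_loc w l).
Proof.
move=> sep Lcl nL; have L0 : L 0 by case: Lsub.
have [||eps eps0 [w pw hw]] := sep above_distances _ above_distances_closed _
    above_distances_convex (above_distances_neq0 Lcl nL).
- by exists (ip (x0 - 0) (x0 - 0)); exact: above_distances_ip.
- by move=> a [pa _]; apply/positive_coneP.
exists w => //; exists (Num.sqrt eps); first by rewrite sqrtr_gt0.
move=> l Ll; apply: ler_sqr_nneg; first exact: rnorm_ge0.
rewrite (sqr_sqrtr (ltW eps0)) -lecR rmorphXn /= -rnormE.
rewrite -raddfB norm_to_completion sinormK /=.
exact: hw (above_distances_ip Ll).
Qed.

End Submodule.

End ModuleSeparation.

Lemma convex_to_submodule (R : realType) (A : cstarAlgType R)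
  (A_comm : commutative (@cmul R A)) : convex_separation A -> submodule_separation A.
Proof.
move=> sep E L Lcl Lsub.
have ncl x0 (w : state A) (d : R) : 0 < d ->
    (forall l, L l -> d <= rnorm (iota_loc w x0 - iota_loc w l)) ->
    ~ closure (iota_loc w @` L) (iota_loc w x0).
  move=> d0 h /closureP /(_ d d0)[_ [l Ll <-]]; rewrite ltNge => /negP; apply.
  exact: h.
split=> [x0 nL|LT].
  have [w pw [d d0 h]] := separating_state A_comm Lsub sep Lcl nL.
  by exists w => //; exact: ncl h.
have [x0 nL] : exists x0, ~ L x0.
  apply: contrapT => h; apply: LT; apply/seteqP; split=> // x _.
  by apply: contrapT => nx; apply: h; exists x.
have [w pw [d d0 h]] := separating_state A_comm Lsub sep Lcl nL.
exists w => //; split.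
  move=> dL; apply: (ncl x0 w d d0 h) => B /nbhs_interior Bx.
  have [|y [/interior_subset By Ly]] := dL _ _ (open_interior B); last by exists y.
  by exists (iota_loc w x0); exact: nbhs_singleton.
have [L0 Llin _] := Lsub.
have [|||v [v0 vL]] := @projection_exists _ _ (iota_loc w @` L) (iota_loc w x0) d _ _ d0.
- by move=> c _ _ [x Lx <-] [y Ly <-]; exists (c *: x + y); [exact: Llin | exact: linearP].
- by exists 0; [|exact: raddf0].
- by move=> _ [l Ll <-]; exact: h.
by move=> oc; apply: v0; have : orthocomp (iota_loc w @` L) v := vL; rewrite oc.
Qed.

Theorem theorem5p8 (R : realType) (A : cstarAlgType R)
    (A_comm : commutative (@cmul R A)) :
  submodule_separation A /\
  convex_separation A /\
  (convex_separation A -> submodule_separation A).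
Proof.
have b := commutative_convex_separation A_comm.
by split; [exact: convex_to_submodule | split=> //; exact: convex_to_submodule].
Qed.
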